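(* Suppose $0\le\alpha_3\le\alpha_2\le\alpha_1\le\pi/4$. Then $\mu(U(\alpha_1,\alpha_2,\alpha_3))=4$ if $(\alpha_1,\alpha_2,\alpha_3)\in\mathcal{S}_{\mathrm{EF}}$ and $\mu(U(\alpha_1,\alpha_2,\alpha_3))=5$ if $(\alpha_1,\alpha_2,\alpha_3)\in\mathcal{S}_{\mathrm{E}}$. Moreover, $U(\alpha_1,\alpha_2,\alpha_3)$ can be verified by an entanglement-free protocol iff $(\alpha_1,\alpha_2,\alpha_3)\in\mathcal{S}_{\mathrm{EF}}$.
   Context: $U(\alpha_1,\alpha_2,\alpha_3)=\exp[-i(\alpha_1\sigma_1\otimes\sigma_1+\alpha_2\sigma_2\otimes\sigma_2+\alpha_3\sigma_3\otimes\sigma_3)]$ is the canonical two-qubit unitary, where $\sigma_1,\sigma_2,\sigma_3$ are the Pauli operators. $\mathcal{S}=\{(\alpha_1,\alpha_2,\alpha_3): 0\le\alpha_3\le\alpha_2\le\alpha_1\le\pi/4\}$, $\mathcal{S}_{\mathrm{E}}=\{(\alpha,\alpha,\alpha): 0<\alpha<\pi/4\}$, and $\mathcal{S}_{\mathrm{EF}}=\mathcal{S}\setminus\mathcal{S}_{\mathrm{E}}$. A verification protocol for a unitary $U$ consists of pure product input test states and, for each output state $U|\psi_j\rangle$, a verification protocol based on nonadaptive local projective measurements; it is ordinary if each output-state verification operator has positive spectral gap. One experimental setting means the preparation of a pure product input state together with one nonadaptive local projective measurement on the output state; $\mu(U)$ is the minimum number of experimental settings required to verify $U$ by ordinary protocols.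 A verification protocol is entanglement free if all input test states and the corresponding output states are product states and all measurements are local projective measurements. *)

(* Defs.v *)
From HB Require Import structures.
From mathcomp Require Import all_boot all_order all_algebra.
From mathcomp Require Import all_classical all_reals.
From mathcomp Require Import topology normedtype sequences trigo.
From mathcomp Require Import complex mxtens.
From Stdlib Require List.

Set Implicit Arguments.
Unset Strict Implicit.
Unset Printing Implicit Defensive.

Import Order.TTheory GRing.Theory Num.Theory.
Import numFieldNormedType.Exports.
Local Open Scope classical_set_scope.
Local Open Scope ring_scope.

Section QuantumDefs.
Variable R : realType.
Local Notation C := R[i].

Definition cI : C := Complex 0 1.
Definition cR (x : R) : C := Complex x 0.
Definition cconj (z : C) : C := Complex (complex.Re z) (- complex.Im z).
Definition adj {m n : nat} (A : 'M[C]_(m, n)) : 'M[C]_(n, m) :=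
  \matrix_(i, j) cconj (A j i).

Definition sigma1 : 'M[C]_2 := \matrix_(i, j) if i == j then 0 else 1.
Definition sigma2 : 'M[C]_2 :=
  \matrix_(i, j) if i == j then 0 else if (i == 0 :> nat) then - cI else cI.
Definition sigma3 : 'M[C]_2 :=
  \matrix_(i, j) if i == j then (if (i == 0 :> nat) then 1 else -1) else 0.

Definition canonH (a1 a2 a3 : R) : 'M[C]_(2 * 2) :=
  cR a1 *: (sigma1 *t sigma1) + cR a2 *: (sigma2 *t sigma2)
  + cR a3 *: (sigma3 *t sigma3).

Definition is_mexp {n : nat} (A E : 'M[C]_n) : Prop :=
  forall i j,
    ((fun N : nat => complex.Re ((\sum_(k < N) (cR (k`!%:R)^-1) *: A ^+ k) i j))
       @ \oo --> complex.Re (E i j)) /\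
    ((fun N : nat => complex.Im ((\sum_(k < N) (cR (k`!%:R)^-1) *: A ^+ k) i j))
       @ \oo --> complex.Im (E i j)).

Definition is_canonU (a1 a2 a3 : R) (U : 'M[C]_(2 * 2)) : Prop :=
  is_mexp (- cI *: canonH a1 a2 a3) U.

Definition inS (a1 a2 a3 : R) : Prop := 0 <= a3 /\ a3 <= a2 /\ a2 <= a1 /\ a1 <= pi / 4.
Definition inSE (a1 a2 a3 : R) : Prop := a1 = a2 /\ a2 = a3 /\ 0 < a1 /\ a1 < pi / 4.
Definition inSEF (a1 a2 a3 : R) : Prop := inS a1 a2 a3 /\ ~ inSE a1 a2 a3.

Definition ket_bra {n : nat} (v : 'cV[C]_n) : 'M[C]_n := v *m adj v.

Definition unit_vec {n : nat} (v : 'cV[C]_n) : Prop := adj v *m v = 1%:M.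
Definition onb2 (V : 'M[C]_2) : Prop := adj V *m V = 1%:M.

Definition product_state (v : 'cV[C]_(2 * 2)) : Prop :=
  exists (a b : 'cV[C]_2), v = a *t b.

(** One experimental measurement setting on the output state: a nonadaptive
    local projective measurement, i.e. an orthonormal basis on each qubit
    (coarse-grainings, including the trivial measurement, are obtained through
    the accepted outcome sets).  The tests built on this setting are given by
    sets A of accepted outcomes, each chosen with weight (probability) wt A. *)
Record lsetting := LSetting {
  basisA : 'M[C]_2;
  basisB : 'M[C]_2;
  wt : {ffun {set ('I_2 * 'I_2)} -> R}
}.

Definition test_op (s : lsetting) (A : {set ('I_2 * 'I_2)}) : 'M[C]_(2 * 2) :=
  \sum_(o in A) (ket_bra (col o.1 (basisA s)) *t ket_bra (col o.2 (basisB s))).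

Definition valid_state_protocol (phi : 'cV[C]_(2 * 2)) (P : seq lsetting) : Prop :=
  (forall s, List.In s P -> onb2 (basisA s) /\ onb2 (basisB s)) /\
  (forall s A, List.In s P -> 0 <= wt s A) /\
  (forall s A, List.In s P -> 0 < wt s A -> test_op s A *m phi = phi) /\
  \sum_(s <- P) \sum_A wt s A = 1.

Definition ver_op (P : seq lsetting) : 'M[C]_(2 * 2) :=
  \sum_(s <- P) \sum_A (cR (wt s A) *: test_op s A).

(** positive spectral gap: 1 - beta(Omega) > 0, where beta(Omega) is the
    largest value of <v|Omega|v>/<v|v> on the orthogonal complement of phi *)
Definition pos_spectral_gap (phi : 'cV[C]_(2 * 2)) (Om : 'M[C]_(2 * 2)) : Prop :=
  exists delta : R, 0 < delta /\
    forall v : 'cV[C]_(2 * 2), adj phi *m v = 0 ->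
      complex.Re ((adj v *m Om *m v) 0 0) <= (1 - delta) * complex.Re ((adj v *m v) 0 0).

Record gate_test := GateTest {
  inA : 'cV[C]_2;
  inB : 'cV[C]_2;
  out_prot : seq lsetting
}.

Definition in_state (t : gate_test) : 'cV[C]_(2 * 2) := inA t *t inB t.

Definition valid_gate_protocol (U : 'M[C]_(2 * 2)) (G : seq gate_test) : Prop :=
  forall t, List.In t G ->
    unit_vec (inA t) /\ unit_vec (inB t) /\
    valid_state_protocol (U *m in_state t) (out_prot t).

Definition ordinary (U : 'M[C]_(2 * 2)) (G : seq gate_test) : Prop :=
  forall t, List.In t G -> pos_spectral_gap (U *m in_state t) (ver_op (out_prot t)).

(** quantum channels given by Kraus operators *)
Definition is_channel (Ks : seq 'M[C]_(2 * 2)) : Prop :=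
  \sum_(K <- Ks) (adj K *m K) = 1%:M.
Definition chan (Ks : seq 'M[C]_(2 * 2)) (rho : 'M[C]_(2 * 2)) : 'M[C]_(2 * 2) :=
  \sum_(K <- Ks) (K *m rho *m adj K).

Definition verifies (U : 'M[C]_(2 * 2)) (G : seq gate_test) : Prop :=
  forall Ks, is_channel Ks ->
    (forall t, List.In t G ->
       \tr (ver_op (out_prot t) *m chan Ks (ket_bra (in_state t))) = 1) ->
    forall rho, chan Ks rho = U *m rho *m adj U.

Definition num_settings (G : seq gate_test) : nat :=
  \sum_(t <- G) size (out_prot t).

Definition mu_is (U : 'M[C]_(2 * 2)) (n : nat) : Prop :=
  (exists G, [/\ valid_gate_protocol U G, ordinary U G, verifies U G
                 & num_settings G = n]) /\
  (forall G, valid_gate_protocol U G -> ordinary U G -> verifies U G ->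
             (n <= num_settings G)%N).

(** entanglement-free verifiability: inputs (by construction) and outputs are
    product states, measurements are local projective (by construction) *)
Definition ef_verifiable (U : 'M[C]_(2 * 2)) : Prop :=
  exists G, [/\ valid_gate_protocol U G, verifies U G
              & forall t, List.In t G -> product_state (U *m in_state t)].

End QuantumDefs.

(* Main.v *)
(* In the Bell basis the gate is diagonal with unimodular eigenvalues [w1, .., w4],
   and a vector with Bell amplitudes [m1, .., m4] (in the magic basis) is a product
   state iff [\sum_k m_k ^ 2 = 0].  Hence a product input has a product output iff
   moreover [\sum_k w_k ^ 2 * m_k ^ 2 = 0], and this condition does not see the
   signs of the amplitudes.  A solution without zero amplitude gives, by sign
   changes, four product inputs that span the space and are not orthogonal to
   one of them; a channel acting as the gate on these is the gate.  Such a
   solution exists unless exactly three of the [w_k ^ 2] coincide, which is the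
   case [inSE]: then product outputs only come from inputs orthogonal to the
   singlet.  Inputs that do not span cannot exclude the gate preceded by
   a reflection, and a single setting has a spectral gap only for product states,
   so that case needs one entangled output, verified with two settings. *)
Require Import Defs.
From HB Require Import structures.
From mathcomp Require Import all_boot all_order all_algebra.
From mathcomp Require Import all_classical all_reals.
From mathcomp Require Import topology normedtype sequences trigo.
From mathcomp Require Import complex mxtens.
From mathcomp Require Import ring lra.
From Stdlib Require List.

Import Order.TTheory GRing.Theory Num.Theory.
Local Open Scope ring_scope.
Set Implicit Arguments.
Unset Strict Implicit.
Unset Printing Implicit Defensive.

(** * Conjugation, adjoints and the inner product of complex vectors *)

Section ComplexVectors.
Variable R : realType.
Local Notation C := R[i].

Lemma cconjE (z : C) : cconj z = conjc z.
Proof. by case: z. Qed.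

Lemma cconjD (x y : C) : cconj (x + y) = cconj x + cconj y.
Proof. by rewrite !cconjE rmorphD. Qed.
Lemma cconjB (x y : C) : cconj (x - y) = cconj x - cconj y.
Proof. by rewrite !cconjE rmorphB. Qed.
Lemma cconjN (x : C) : cconj (- x) = - cconj x.
Proof. by rewrite !cconjE rmorphN. Qed.
Lemma cconjM (x y : C) : cconj (x * y) = cconj x * cconj y.
Proof. by rewrite !cconjE rmorphM. Qed.
Lemma cconj_nat n : cconj (n%:R : C) = n%:R.
Proof. by rewrite cconjE rmorph_nat. Qed.
Lemma cconj0 : cconj (0 : C) = 0. Proof. exact: (cconj_nat 0). Qed.
Lemma cconj1 : cconj (1 : C) = 1. Proof. exact: (cconj_nat 1). Qed.
Lemma cconjK (x : C) : cconj (cconj x) = x.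
Proof. by rewrite !cconjE conjcK. Qed.
Lemma cconjV (x : C) : cconj x^-1 = (cconj x)^-1.
Proof. by rewrite !cconjE fmorphV. Qed.
Lemma cconj_sum I (r : seq I) (P : pred I) (F : I -> C) :
  cconj (\sum_(i <- r | P i) F i) = \sum_(i <- r | P i) cconj (F i).
Proof.
by rewrite cconjE rmorph_sum; apply: eq_bigr => i _; rewrite cconjE.
Qed.
Lemma cconj_eq0 (x : C) : (cconj x == 0) = (x == 0).
Proof. by rewrite cconjE conjc_eq0. Qed.
Lemma cconj_cR (x : R) : cconj (cR x) = cR x.
Proof. by rewrite /cconj /= oppr0. Qed.
Lemma cconj_cI : cconj (cI R) = - cI R.
Proof. by apply/eqP; rewrite eq_complex /= oppr0 !eqxx. Qed.
Lemma cI2 : cI R * cI R = -1.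
Proof. by rewrite -expr2 sqr_i. Qed.

Lemma cR0 : cR 0 = 0 :> C. Proof. by []. Qed.
Lemma cRD (x y : R) : cR (x + y) = cR x + cR y.
Proof. exact: (rmorphD (real_complex R)). Qed.
Lemma cRM (x y : R) : cR (x * y) = cR x * cR y.
Proof. exact: (rmorphM (real_complex R)). Qed.
Lemma cRB (x y : R) : cR (x - y) = cR x - cR y.
Proof. exact: (rmorphB (real_complex R)). Qed.
Lemma cRV (x : R) : cR x^-1 = (cR x)^-1.
Proof. exact: (fmorphV (real_complex R)). Qed.
Lemma cR_sum I (r : seq I) (P : pred I) (F : I -> R) :
  cR (\sum_(i <- r | P i) F i) = \sum_(i <- r | P i) cR (F i).
Proof. exact: (rmorph_sum (real_complex R)). Qed.
Lemma cR_nat n : cR n%:R = n%:R :> C.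
Proof. exact: (rmorph_nat (real_complex R)). Qed.

Lemma ReD (x y : C) : complex.Re (x + y) = complex.Re x + complex.Re y.
Proof. by case: x y => [a b] [c d]. Qed.
Lemma Re_sum I (r : seq I) (P : pred I) (F : I -> C) :
  complex.Re (\sum_(i <- r | P i) F i) = \sum_(i <- r | P i) complex.Re (F i).
Proof. by rewrite (big_morph _ ReD (erefl : complex.Re (0 : C) = 0)). Qed.
Lemma Re_cRM (x : R) (z : C) : complex.Re (cR x * z) = x * complex.Re z.
Proof. by case: z => a b /=; rewrite mul0r subr0. Qed.

Definition sqmod (z : C) : R := complex.Re z ^+ 2 + complex.Im z ^+ 2.

Lemma sqmodE (z : C) : cR (sqmod z) = cconj z * z.
Proof.
case: z => a b; apply/eqP; rewrite eq_complex /sqmod /=; apply/andP.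
by split; apply/eqP; ring.
Qed.
Lemma sqmod_ge0 z : 0 <= sqmod z.
Proof. by rewrite addr_ge0 ?sqr_ge0. Qed.
Lemma sqmod_eq0 z : (sqmod z == 0) = (z == 0).
Proof.
rewrite /sqmod paddr_eq0 ?sqr_ge0 // !sqrf_eq0.
by case: z => a b; rewrite eq_complex.
Qed.
Lemma sqmodM x y : sqmod (x * y) = sqmod x * sqmod y.
Proof. by case: x y => a b [c d]; rewrite /sqmod /=; ring. Qed.
Lemma sqmod_conj x : sqmod (cconj x) = sqmod x.
Proof. by case: x => a b; rewrite /sqmod /=; ring. Qed.

Lemma adjE m n (A : 'M[C]_(m, n)) : adj A = map_mx (@conjc R) A^T.
Proof. by apply/matrixP => i j; rewrite !mxE cconjE. Qed.
Lemma adjK m n (A : 'M[C]_(m, n)) : adj (adj A) = A.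
Proof. by apply/matrixP => i j; rewrite !mxE cconjK. Qed.
Lemma adjM m n p (A : 'M[C]_(m, n)) (B : 'M[C]_(n, p)) :
  adj (A *m B) = adj B *m adj A.
Proof. by rewrite !adjE trmx_mul map_mxM. Qed.
Lemma adjD m n (A B : 'M[C]_(m, n)) : adj (A + B) = adj A + adj B.
Proof. by apply/matrixP => i j; rewrite !mxE cconjD. Qed.
Lemma adj0 m n : adj (0 : 'M[C]_(m, n)) = 0.
Proof. by apply/matrixP => i j; rewrite !mxE cconj0. Qed.
Lemma adjN m n (A : 'M[C]_(m, n)) : adj (- A) = - adj A.
Proof. by apply/matrixP => i j; rewrite !mxE cconjN. Qed.
Lemma adjZ m n c (A : 'M[C]_(m, n)) : adj (c *: A) = cconj c *: adj A.
Proof. by apply/matrixP => i j; rewrite !mxE cconjM. Qed.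
Lemma adj1 n : adj (1%:M : 'M[C]_n) = 1%:M.
Proof. by rewrite adjE trmx1 map_mx1. Qed.
Lemma adj_sum m n I (r : seq I) (P : pred I) (F : I -> 'M[C]_(m, n)) :
  adj (\sum_(i <- r | P i) F i) = \sum_(i <- r | P i) adj (F i).
Proof. exact: (big_morph _ (@adjD m n) (@adj0 m n)). Qed.
Lemma adj_tens m n p q (A : 'M[C]_(m, n)) (B : 'M[C]_(p, q)) :
  adj (A *t B) = adj A *t adj B.
Proof. by rewrite !adjE trmx_tens map_mxT. Qed.
Lemma adj_eq0 m n (A : 'M[C]_(m, n)) : (adj A == 0) = (A == 0).
Proof.
apply/eqP/eqP => [A0|->]; last exact: adj0.
by rewrite -[A]adjK A0 adj0.
Qed.

Definition dot {n} (v w : 'cV[C]_n) : C := (adj v *m w) 0 0.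
Definition nrm {n} (v : 'cV[C]_n) : R := complex.Re (dot v v).

Lemma dotE n (v w : 'cV[C]_n) : dot v w = \sum_i cconj (v i 0) * w i 0.
Proof. by rewrite /dot mxE; apply: eq_bigr => i _; rewrite mxE. Qed.
Lemma dot_mx n (v w : 'cV[C]_n) : adj v *m w = (dot v w)%:M.
Proof. by rewrite [LHS]mx11_scalar. Qed.
Lemma dotC n (v w : 'cV[C]_n) : dot w v = cconj (dot v w).
Proof.
by rewrite !dotE cconj_sum; apply: eq_bigr => i _; rewrite cconjM cconjK mulrC.
Qed.
Lemma dotDr n (u v w : 'cV[C]_n) : dot u (v + w) = dot u v + dot u w.
Proof. by rewrite /dot mulmxDr mxE. Qed.
Lemma dotNr n (u v : 'cV[C]_n) : dot u (- v) = - dot u v.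
Proof. by rewrite /dot mulmxN mxE. Qed.
Lemma dotBr n (u v w : 'cV[C]_n) : dot u (v - w) = dot u v - dot u w.
Proof. by rewrite dotDr dotNr. Qed.
Lemma dotZr n c (u v : 'cV[C]_n) : dot u (c *: v) = c * dot u v.
Proof. by rewrite /dot -scalemxAr mxE. Qed.
Lemma dotDl n (u v w : 'cV[C]_n) : dot (u + v) w = dot u w + dot v w.
Proof. by rewrite /dot adjD mulmxDl mxE. Qed.
Lemma dotZl n c (u v : 'cV[C]_n) : dot (c *: u) v = cconj c * dot u v.
Proof. by rewrite /dot adjZ -scalemxAl mxE. Qed.
Lemma dot0r n (u : 'cV[C]_n) : dot u 0 = 0.
Proof. by rewrite /dot mulmx0 mxE. Qed.
Lemma dotMr n m (A : 'M[C]_(m, n)) u v : dot u (A *m v) = dot (adj A *m u) v.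
Proof. by rewrite /dot adjM adjK mulmxA. Qed.
Lemma tens_colE m n (a : 'cV[C]_m) (b : 'cV[C]_n) i j :
  (a *t b : 'cV[C]_(m * n)) (mxtens_index (i, j)) 0 = a i 0 * b j 0.
Proof.
rewrite mxE mxtens_indexK /=.
by congr (a _ _ * b _ _); apply: ord1.
Qed.
Lemma sum_mxtens (V : nmodType) m n (F : 'I_(m * n) -> V) :
  \sum_k F k = \sum_i \sum_j F (mxtens_index (i, j)).
Proof.
rewrite pair_big /= (reindex (@mxtens_index m n)) /=.
  by apply: eq_bigr => -[i j] _.
exists (@mxtens_unindex m n) => k _; first exact: mxtens_indexK.
exact: mxtens_unindexK.
Qed.
Lemma dot_tens m n (a c : 'cV[C]_m) (b d : 'cV[C]_n) :
  @dot (m * n) (a *t b) (c *t d) = dot a c * dot b d.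
Proof.
rewrite !dotE sum_mxtens big_distrlr /=; apply: eq_bigr => i _.
by apply: eq_bigr => j _; rewrite !tens_colE cconjM; ring.
Qed.

Lemma nrmE n (v : 'cV[C]_n) : nrm v = \sum_i sqmod (v i 0).
Proof.
rewrite /nrm dotE Re_sum; apply: eq_bigr => i _.
by rewrite -sqmodE.
Qed.
Lemma dot_nrm n (v : 'cV[C]_n) : dot v v = cR (nrm v).
Proof.
by rewrite nrmE cR_sum dotE; apply: eq_bigr => i _; rewrite sqmodE.
Qed.
Lemma nrm_ge0 n (v : 'cV[C]_n) : 0 <= nrm v.
Proof. by rewrite nrmE sumr_ge0 // => i _; apply: sqmod_ge0. Qed.
Lemma nrm_eq0 n (v : 'cV[C]_n) : (nrm v == 0) = (v == 0).
Proof.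
rewrite nrmE psumr_eq0 => [|i _]; last exact: sqmod_ge0.
apply/allP/eqP => [v0|-> i _]; last by rewrite mxE sqmod_eq0 eqxx.
apply/matrixP => i j; rewrite (ord1 j) mxE; apply/eqP; rewrite -sqmod_eq0.
exact: (implyP (v0 i (mem_index_enum i))).
Qed.
Lemma unit_vecE n (v : 'cV[C]_n) : unit_vec v <-> dot v v = 1.
Proof.
rewrite /unit_vec dot_mx; split=> [vv|->] //.
by move/matrixP: vv => /(_ 0 0); rewrite !mxE eqxx !mulr1n.
Qed.

End ComplexVectors.

(** * Passing a test with certainty, and which sets of inputs determine the gate *)

Section Protocols.
Variable R : realType.
Local Notation C := R[i].

Lemma eq_big_In (V : nmodType) (T : Type) (s : seq T) (F G : T -> V) :
  (forall x, List.In x s -> F x = G x) ->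
  \sum_(x <- s) F x = \sum_(x <- s) G x.
Proof.
elim: s => [|x s IH] FG; first by rewrite !big_nil.
rewrite !big_cons FG; last by left.
by congr (_ + _); apply: IH => y ys; apply: FG; right.
Qed.

Lemma ket_braM n (v w : 'cV[C]_n) : ket_bra v *m w = dot v w *: v.
Proof. by rewrite /ket_bra -mulmxA dot_mx mul_mx_scalar. Qed.

Lemma adj_ket_bra n (v : 'cV[C]_n) : adj (ket_bra v) = ket_bra v.
Proof. by rewrite /ket_bra adjM adjK. Qed.

Lemma ket_braZ n c (v : 'cV[C]_n) : ket_bra (c *: v) = (cconj c * c) *: ket_bra v.
Proof. by rewrite /ket_bra adjZ -scalemxAl -scalemxAr scalerA mulrC. Qed.

Lemma ket_bra_tens m n (a : 'cV[C]_m) (b : 'cV[C]_n) :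
  ket_bra a *t ket_bra b = @ket_bra R (m * n) (a *t b).
Proof. by rewrite /ket_bra -tensmx_mul -adj_tens. Qed.

Definition out_vec (s : lsetting R) (o : 'I_2 * 'I_2) : 'cV[C]_(2 * 2) :=
  col o.1 (basisA s) *t col o.2 (basisB s).

Lemma test_opE s A : test_op s A = \sum_(o in A) ket_bra (out_vec s o).
Proof. by apply: eq_bigr => o _; rewrite ket_bra_tens. Qed.

Lemma adj_test_op (s : lsetting R) A : adj (test_op s A) = test_op s A.
Proof.
by rewrite test_opE adj_sum; apply: eq_bigr => o _; rewrite adj_ket_bra.
Qed.

Lemma adj_ver_op (P : seq (lsetting R)) : adj (ver_op P) = ver_op P.
Proof.
rewrite /ver_op adj_sum; apply: eq_bigr => s _; rewrite adj_sum.
by apply: eq_bigr => A _; rewrite adjZ cconj_cR adj_test_op.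
Qed.

Lemma onb2_dot (V : 'M[C]_2) i j : onb2 V -> dot (col i V) (col j V) = (i == j)%:R.
Proof.
move/matrixP => /(_ i j); rewrite !mxE => <-; rewrite dotE.
by apply: eq_bigr => k _; rewrite !mxE.
Qed.

Lemma out_vec_dot s o o' : onb2 (basisA s) -> onb2 (basisB s) ->
  dot (out_vec s o) (out_vec s o') = (o == o')%:R.
Proof.
move=> oA oB; rewrite /out_vec dot_tens !onb2_dot //.
by rewrite -natrM mulnb -xpair_eqE; case: o o' => [? ?] [].
Qed.

Lemma test_op_dot s A o v : onb2 (basisA s) -> onb2 (basisB s) ->
  dot (out_vec s o) (test_op s A *m v) = (o \in A)%:R * dot (out_vec s o) v.
Proof.
move=> oA oB; rewrite dotMr adj_test_op test_opE mulmx_suml.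
under eq_bigr => o' _ do rewrite ket_braM out_vec_dot //.
have [oAin|oAn] := boolP (o \in A).
  rewrite (bigD1 o) //= eqxx scale1r big1 ?addr0 ?mul1r // => o' /andP[_ /negPf].
  by move=> ->; rewrite scale0r.
rewrite big1 ?mul0r => [|o' o'A]; first by rewrite /dot adj0 mul0mx mxE.
by case: eqP => [e|_]; [case/negP: oAn; rewrite -e | rewrite scale0r].
Qed.

Lemma test_op_out_vec s (A : {set 'I_2 * 'I_2}) o :
  onb2 (basisA s) -> onb2 (basisB s) -> o \in A ->
  test_op s A *m out_vec s o = out_vec s o.
Proof.
move=> oA oB oin; rewrite test_opE mulmx_suml (bigD1 o) //=.
rewrite ket_braM out_vec_dot // eqxx scale1r big1 ?addr0 // => o' /andP[_ ne].
by rewrite ket_braM out_vec_dot // (negPf ne) scale0r.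
Qed.

(** The vector [v] is left free because the lemma serves both the target state and, in
    [single_setting_product], a product outcome vector. *)
Lemma ver_op_fix (P : seq (lsetting R)) (v : 'cV[C]_(2 * 2)) :
  (forall s A, List.In s P -> 0 <= wt s A) ->
  (forall s A, List.In s P -> 0 < wt s A -> test_op s A *m v = v) ->
  \sum_(s <- P) \sum_A wt s A = 1 ->
  ver_op P *m v = v.
Proof.
move=> w0 wfix w1; rewrite /ver_op mulmx_suml.
transitivity (\sum_(s <- P) \sum_A cR (wt s A) *: v).
  apply: eq_big_In => s sP; rewrite mulmx_suml; apply: eq_bigr => A _.
  rewrite -scalemxAl; have := w0 s A sP; rewrite le_eqVlt => /predU1P[<-|wpos].
    by rewrite !scale0r.
  by rewrite wfix.
under eq_bigr do rewrite -scaler_suml -cR_sum.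
by rewrite -scaler_suml -cR_sum w1 scale1r.
Qed.

Lemma valid_ver_op phi (P : seq (lsetting R)) :
  valid_state_protocol phi P -> ver_op P *m phi = phi.
Proof. by case=> _ [w0 [wfix w1]]; apply: ver_op_fix. Qed.

(** Split [v] into its component along [phi] and an orthogonal rest [w]. As [Om] is Hermitian and
    fixes [phi], the cross terms vanish, and the gap costs at least [d] times the squared norm of
    [w]. *)
Lemma gap_bound (phi : 'cV[C]_(2 * 2)) Om :
  unit_vec phi -> adj Om = Om -> Om *m phi = phi -> pos_spectral_gap phi Om ->
  exists2 d : R, 0 < d & forall v, complex.Re (dot v (Om *m v)) <=
    nrm v - d * nrm (v - dot phi v *: phi).
Proof.
move=> /unit_vecE uphi hOm fOm [d [d0 gap]]; exists d => // v.
set a := dot phi v; set w := v - a *: phi.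
have pw : dot phi w = 0 by rewrite dotBr dotZr uphi mulr1 subrr.
have wp : dot w phi = 0 by rewrite dotC pw cconj0.
have pOw : dot phi (Om *m w) = 0 by rewrite dotMr hOm fOm.
have vE : v = a *: phi + w by rewrite addrC subrK.
have gw := gap w; clearbody w; clearbody a.
have -> : dot v (Om *m v) = cR (sqmod a) + dot w (Om *m w).
  rewrite vE mulmxDr -scalemxAr fOm dotDr !dotDl !dotZr !dotZl uphi pOw wp.
  by rewrite sqmodE; ring.
have -> : nrm v = sqmod a + nrm w.
  rewrite {1}vE /nrm dotDr !dotDl !dotZr !dotZl uphi wp pw.
  rewrite !mulr0 addr0 mulr1 add0r mulrC -sqmodE; exact: ReD.
rewrite ReD -[complex.Re (cR _)]/(sqmod a) -[X in _ <= X]addrA lerD2l.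
move: gw; rewrite dot_mx pw -mulmxA => /(_ _)/le_trans; apply.
  by apply/matrixP => i j; rewrite !mxE mul0rn.
by rewrite mulrBl mul1r.
Qed.

Lemma tr_chan (Om : 'M[C]_(2 * 2)) Ks psi :
  \tr (Om *m chan Ks (ket_bra psi)) =
  \sum_(K <- Ks) dot (K *m psi) (Om *m (K *m psi)).
Proof.
rewrite /chan mulmx_sumr raddf_sum /=; apply: eq_bigr => K _.
rewrite /ket_bra !mulmxA -mulmxA -adjM mxtrace_mulC.
by rewrite -!mulmxA dot_mx mxtrace_scalar mulr1n.
Qed.

Lemma channel_dot Ks (v w : 'cV[C]_(2 * 2)) : is_channel Ks ->
  \sum_(K <- Ks) dot (K *m v) (K *m w) = dot v w.
Proof.
move=> chK; rewrite -[in RHS](mul1mx w) -chK mulmx_suml /dot mulmx_sumr summxE.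
by apply: eq_bigr => K _; rewrite adjM !mulmxA.
Qed.

(** Trace preservation makes the squared norms of the [K *m psi] sum to 1. By [gap_bound] the
    passing probability is at most 1 minus [d] times the total weight off [phi], so probability 1
    leaves no such weight in any Kraus branch. *)
Lemma channel_passing Om Ks (psi phi : 'cV[C]_(2 * 2)) :
  is_channel Ks -> unit_vec psi -> unit_vec phi ->
  adj Om = Om -> Om *m phi = phi -> pos_spectral_gap phi Om ->
  \tr (Om *m chan Ks (ket_bra psi)) = 1 ->
  forall K, K \in Ks -> K *m psi = dot phi (K *m psi) *: phi.
Proof.
move=> chK /unit_vecE upsi uphi hOm fOm gap; rewrite tr_chan => tr1 K KKs.
have [d d0 dP] := gap_bound uphi hOm fOm gap.
pose D K := nrm (K *m psi - dot phi (K *m psi) *: phi).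
have D0 : \sum_(K <- Ks) D K == 0.
  rewrite eq_le sumr_ge0 ?andbT => [|K' _]; last exact: nrm_ge0.
  rewrite -(pmulr_rle0 _ d0) mulr_sumr.
  have : \sum_(K <- Ks) complex.Re (dot (K *m psi) (Om *m (K *m psi))) <=
         \sum_(K <- Ks) (nrm (K *m psi) - d * D K).
    by apply: ler_sum => K' _; exact: dP.
  rewrite -Re_sum tr1 sumrB.
  have -> : \sum_(K <- Ks) nrm (K *m psi) = 1.
    by rewrite /nrm -Re_sum channel_dot // upsi.
  by rewrite /=; lra.
move: D0; rewrite psumr_eq0 => [/allP/(_ K KKs)/=|K' _]; last exact: nrm_ge0.
by rewrite nrm_eq0 subr_eq0 => /eqP.
Qed.

(** On each input a Kraus operator acts as a scalar multiple of [U]. Non-orthogonality to the centre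
    [t0] forces the scalars of all inputs to agree, and since the inputs span, every Kraus operator
    is a multiple of [U]. *)
Lemma star_verifies (U : 'M[C]_(2 * 2)) G t0 :
  adj U *m U = 1%:M -> valid_gate_protocol U G -> ordinary U G ->
  List.In t0 G ->
  (forall t, List.In t G -> dot (in_state t0) (in_state t) != 0) ->
  (forall r : 'rV[C]_(2 * 2),
     (forall t, List.In t G -> r *m in_state t = 0) -> r = 0) ->
  verifies U G.
Proof.
move=> uU vG oG t0G star span Ks chK trK rho.
pose c K t := dot (U *m in_state t) (K *m in_state t).
have dotU v w : dot (U *m v) (U *m w) = dot v w by rewrite dotMr mulmxA uU mul1mx.
have uin t : List.In t G -> dot (in_state t) (in_state t) = 1.
  move=> /vG[/unit_vecE uA [/unit_vecE uB _]].
  by rewrite /in_state dot_tens uA uB mulr1.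
have Kin t : List.In t G -> forall K, K \in Ks ->
    K *m in_state t = c K t *: (U *m in_state t).
  move=> tG; apply: (channel_passing chK _ _ _ _ (oG _ tG)).
  - exact/unit_vecE/uin.
  - by apply/unit_vecE; rewrite dotU uin.
  - exact: adj_ver_op.
  - by apply: valid_ver_op; case: (vG _ tG) => _ [].
  - exact: trK.
(* The channel preserves the summed inner products, so the nonzero overlap of the two inputs can be
   cancelled. *)
have cc t t' : List.In t G -> List.In t' G ->
    dot (in_state t) (in_state t') != 0 ->
    \sum_(K <- Ks) cconj (c K t) * c K t' = 1.
  move=> tG t'G ne; apply: (mulIf ne); rewrite mul1r -[RHS](channel_dot _ _ chK).
  rewrite mulr_suml [LHS]big_seq [RHS]big_seq; apply: eq_bigr => K KKs.
  by rewrite Kin // (Kin t') // dotZl dotZr dotU mulrA.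
have ceq t : List.In t G -> forall K, K \in Ks -> c K t = c K t0.
  move=> tG K KKs.
  (* Expanding the square gives four sums, each equal to 1 by [cc], with signs that cancel. *)
  have : \sum_(K <- Ks) sqmod (c K t - c K t0) == 0.
    apply/eqP; apply: (@complexI R); rewrite -[LHS]/(cR _) cR_sum.
    transitivity (\sum_(K <- Ks) (cconj (c K t) * c K t
      + cconj (c K t0) * c K t0 - cconj (c K t0) * c K t
      - cconj (cconj (c K t0) * c K t))).
      apply: eq_bigr => K' _; rewrite sqmodE cconjB cconjM cconjK; ring.
    rewrite !sumrB big_split /= -cconj_sum !cc ?uin ?oner_neq0 ?star //.
    by rewrite cconj1 addrK subrr.
  rewrite psumr_eq0 => [/allP/(_ K KKs)/=|K' _]; last exact: sqmod_ge0.
  by rewrite sqmod_eq0 subr_eq0 => /eqP.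
have KU K : K \in Ks -> K = c K t0 *: U.
  move=> KKs; apply/eqP; rewrite -subr_eq0; apply/eqP/row_matrixP => i.
  rewrite row0; apply: span => t tG.
  by rewrite -row_mul mulmxBl -scalemxAl Kin // ceq // subrr row0.
rewrite /chan big_seq.
transitivity (\sum_(K <- Ks | K \in Ks) (cconj (c K t0) * c K t0) *: (U *m rho *m adj U)).
  apply: eq_bigr => K KKs; rewrite {1 2}(KU K KKs) adjZ.
  by rewrite -!scalemxAl -scalemxAr scalerA mulrC.
by rewrite -big_seq -scaler_suml cc ?uin ?oner_neq0 // scale1r.
Qed.

(** The reflection [S] in the hyperplane orthogonal to [v] fixes every input, so [U *m S] passes all
    tests. It is a different channel, because conjugation by [S] is not trivial. *)
Lemma orthogonal_not_verifies (U : 'M[C]_(2 * 2)) G (v : 'cV[C]_(2 * 2)) :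
  adj U *m U = 1%:M -> valid_gate_protocol U G ->
  v != 0 -> (forall t, List.In t G -> dot v (in_state t) = 0) -> ~ verifies U G.
Proof.
move=> uU vG v0 orth ver.
pose k : R := 2 / nrm v.
pose S : 'M[C]_(2 * 2) := 1%:M - cR k *: ket_bra v.
have nv0 : nrm v != 0 by rewrite nrm_eq0.
have Sv : S *m v = - v.
  rewrite mulmxBl mul1mx -scalemxAl ket_braM dot_nrm scalerA -cRM /k divfK //.
  by rewrite cR_nat scaler_nat mulr2n opprD addrA subrr sub0r.
have hS : adj S = S by rewrite adjD adj1 adjN adjZ adj_ket_bra cconj_cR.
have SS : S *m S = 1%:M.
  rewrite {2}/S mulmxBr mulmx1 -scalemxAr /ket_bra mulmxA Sv mulNmx.
  by rewrite scalerN opprK subrK.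
have ch : is_channel [:: U *m S].
  by rewrite /is_channel big_seq1 adjM hS mulmxA -(mulmxA S) uU mulmx1.
have chE rho : chan [:: U *m S] rho = U *m (S *m rho *m S) *m adj U.
  by rewrite /chan big_seq1 adjM hS !mulmxA.
have trG t : List.In t G ->
    \tr (ver_op (out_prot t) *m chan [:: U *m S] (ket_bra (in_state t))) = 1.
  move=> tG; rewrite tr_chan big_seq1 -mulmxA.
  have -> : S *m in_state t = in_state t.
    by rewrite mulmxBl mul1mx -scalemxAl ket_braM orth // scale0r scaler0 subr0.
  have [/unit_vecE uA [/unit_vecE uB /valid_ver_op ->]] := vG t tG.
  by rewrite dotMr mulmxA uU mul1mx dot_tens uA uB mulr1.
(* If both channels agreed, conjugation by [S] would fix [v *m adj x]; since [S] negates [v], it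
   would have to negate every [adj x] as well. *)
have SE (x : 'cV[C]_(2 * 2)) : adj x *m S = - adj x.
  have cancelU (M : 'M[C]_(2 * 2)) : adj U *m (U *m M *m adj U) *m U = M.
    by rewrite !mulmxA uU mul1mx -mulmxA uU mulmx1.
  have SvS : S *m (v *m adj x) *m S = v *m adj x.
    by rewrite -[LHS]cancelU -chE (ver _ ch trG) cancelU.
  have : adj v *m (v *m (adj x *m S)) = adj v *m (v *m - adj x).
    by congr (_ *m _); rewrite mulmxN -SvS !mulmxA Sv !mulNmx opprK.
  rewrite !mulmxA !dot_mx dot_nrm -mulmxA !mul_scalar_mx => /(congr1 ( *:%R (cR (nrm v)^-1))).
  by rewrite !scalerA -cRM mulVf // !scale1r.
have S1 : S = - 1%:M.
  apply/matrixP => i j; have := SE (delta_mx i 0) => /matrixP/(_ 0 j).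
  have -> : adj (delta_mx i 0 : 'cV[C]_(2 * 2)) = delta_mx 0 i.
    apply/matrixP => a b; rewrite !mxE; case: (_ && _) / andP => [[-> ->]|].
      by rewrite cconj_nat.
    by rewrite cconj0 => ne; case: andP => // -[? ?]; case: ne.
  rewrite -rowE !mxE /=.
  by rewrite eq_sym => ->.
(* Now [S] is minus the identity, so [ket_bra v] is [nrm v] times the identity. Comparing traces
   gives [nrm v = nrm v * 4], a contradiction. *)
have : ket_bra v = cR (2 / k) *: 1%:M.
  have /eqP := S1; rewrite subr_eq addrC -subr_eq opprK => /eqP S2.
  have k0 : k != 0 by rewrite mulf_neq0 ?invr_eq0 // pnatr_eq0.
  rewrite (_ : ket_bra v = cR k^-1 *: (cR k *: ket_bra v)); last first.
    by rewrite scalerA -cRM mulVf // scale1r.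
  by rewrite -S2 -mulr2n -scaler_nat scalerA mulrC cRM cR_nat.
move/(congr1 mxtrace); rewrite /ket_bra mxtrace_mulC dot_mx mxtrace_scalar mulr1n.
rewrite mxtraceZ mxtrace1 dot_nrm -cR_nat -cRM => /(congr1 (@complex.Re R)) /=.
have -> : 2 / k = nrm v by rewrite /k invf_div mulrCA divff ?mulr1 // pnatr_eq0.
have : 0 < nrm v by rewrite lt_neqAle eq_sym nv0 nrm_ge0.
by move: (nrm v) => x; clear=> x0 xE; have {xE} : x = x * 4 by []; lra.
Qed.
End Protocols.

(** * Computational-basis coordinates, normalization and orthogonal vectors *)

Section Coordinates.
Variable R : realType.
Local Notation C := R[i].

Definition cv2 (x y : C) : 'cV[C]_2 := \col_k nth 0 [:: x; y] k.
Definition cv4 (x00 x01 x10 x11 : C) : 'cV[C]_(2 * 2) :=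
  \col_k nth 0 [:: x00; x01; x10; x11] k.

Lemma cv2_ex v : exists x y, v = cv2 x y.
Proof.
exists (v 0 0), (v 1 0); apply/colP => i; rewrite mxE.
by case: i => [[|[|//]]] Hi /=; congr (v _ _); apply: val_inj.
Qed.

Lemma cv4_ex v : exists x00 x01 x10 x11, v = cv4 x00 x01 x10 x11.
Proof.
exists (v (mxtens_index (0, 0)) 0), (v (mxtens_index (0, 1)) 0),
  (v (mxtens_index (1, 0)) 0), (v (mxtens_index (1, 1)) 0).
apply/colP => i; rewrite mxE.
by case: i => [[|[|[|[|//]]]]] Hi /=; congr (v _ _); apply: val_inj.
Qed.

Lemma tens_cv2 (a b c d : C) :
  cv2 a b *t cv2 c d = cv4 (a * c) (a * d) (b * c) (b * d).
Proof.
apply/matrixP => i j; rewrite !mxE.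
by case: i => [[|[|[|[|//]]]]] Hi.
Qed.

Lemma sum2 (V : nmodType) (F : 'I_2 -> V) : \sum_i F i = F 0 + F 1.
Proof.
rewrite !big_ord_recl big_ord0 addr0; congr (F _ + F _).
exact: val_inj.
Qed.

Lemma dot_cv2 (a b c d : C) : dot (cv2 a b) (cv2 c d) = cconj a * c + cconj b * d.
Proof. by rewrite dotE sum2 !mxE. Qed.

Lemma sum4 (V : nmodType) (F : 'I_(2 * 2) -> V) : \sum_i F i =
  F (mxtens_index (0, 0)) + F (mxtens_index (0, 1)) +
  F (mxtens_index (1, 0)) + F (mxtens_index (1, 1)).
Proof. by rewrite sum_mxtens !sum2 addrA. Qed.

Lemma dot_cv4 (a b c d x y z w : C) : dot (cv4 a b c d) (cv4 x y z w) =
  cconj a * x + cconj b * y + cconj c * z + cconj d * w.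
Proof. by rewrite dotE sum4 !mxE. Qed.

Lemma nrm_cv4 (x y z w : C) :
  nrm (cv4 x y z w) = sqmod x + sqmod y + sqmod z + sqmod w.
Proof. by rewrite nrmE sum4 !mxE. Qed.

Lemma scale_tens (k : C) m n (a : 'cV[C]_m) (b : 'cV[C]_n) :
  k *: (a *t b) = (k *: a) *t b.
Proof. by apply/matrixP => i j; rewrite !mxE mulrA. Qed.

Lemma tens_scale (k : C) m n (a : 'cV[C]_m) (b : 'cV[C]_n) :
  k *: (a *t b) = a *t (k *: b).
Proof. by apply/matrixP => i j; rewrite !mxE; ring. Qed.

Lemma normalize n (v : 'cV[C]_n) : v != 0 ->
  exists2 k : C, k != 0 & unit_vec (k *: v).
Proof.
move=> v0; have nv : 0 < nrm v by rewrite lt_neqAle nrm_ge0 eq_sym nrm_eq0 v0.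
exists (cR (Num.sqrt (nrm v))^-1).
  by rewrite (inj_eq (@complexI R) _ 0) invr_eq0 sqrtr_eq0 -ltNge.
apply/unit_vecE; rewrite dotZl dotZr cconj_cR dot_nrm -!cRM mulrA -expr2 exprVn.
by rewrite sqr_sqrtr ?ltW // mulVf // gt_eqF.
Qed.

Lemma dot_neq0 n (v w : 'cV[C]_n) : dot v w != 0 -> v != 0.
Proof.
by apply: contraNneq => ->; rewrite /dot adj0 mul0mx mxE.
Qed.

(** The matrix with the family as columns has rank below [n], hence a nonzero left null row; [v] is
    the adjoint of that row. *)
Lemma short_family_orthogonal n (l : seq 'cV[C]_n) : (size l < n)%N ->
  exists2 v : 'cV[C]_n, v != 0 & forall x, List.In x l -> dot v x = 0.
Proof.
move=> ln; pose M : 'M[C]_(n, size l) := \matrix_(i, j) nth 0 l j i 0.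
have : kermx M != 0.
  rewrite -mxrank_eq0 mxrank_ker -lt0n subn_gt0.
  exact: leq_ltn_trans (rank_leq_col _) ln.
case/rowV0Pn => r /sub_kermxP rM r0; exists (adj r); first by rewrite adj_eq0.
move=> x xl; have : x \in l.
  elim: l xl {ln M rM} => //= y l IH [->|/IH]; rewrite in_cons ?eqxx // => ->.
  exact: orbT.
move=> {}xl; have xi := xl; rewrite -index_mem in xi.
move/matrixP: rM => /(_ 0 (Ordinal xi)); rewrite /dot adjK !mxE => rMx.
rewrite -[RHS]rMx; apply: eq_bigr => i _.
by rewrite mxE nth_index.
Qed.

End Coordinates.

(** * Verification of states: one setting for product states, two for the entangled output *)

Section StateProtocols.
Variable R : realType.
Local Notation C := R[i].

(** Some outcome [o] overlaps [phi], and every test of positive weight, fixing [phi], must accept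
    it. The verification operator then fixes the product vector of [o], and the gap makes that
    vector proportional to [phi]. *)
Lemma single_setting_product phi (s : lsetting R) :
  unit_vec phi -> valid_state_protocol phi [:: s] ->
  pos_spectral_gap phi (ver_op [:: s]) -> product_state phi.
Proof.
move=> uphi vs gap; have [ons [w0 [wfix w1]]] := vs.
have sin : List.In s [:: s] by left.
have [oA oB] := ons s sin.
have [o o0] : exists o, dot (out_vec s o) phi != 0.
  apply/not_existsP => all0; have phi0 : phi = 0.
    have [A wA] : exists A, 0 < wt s A.
      apply/not_existsP => nw; have := w1; rewrite big_seq1 big1 => [/eqP|A _].
        by rewrite eq_sym oner_eq0.
      by apply/eqP; rewrite eq_le w0 // andbT leNgt; apply/negP/nw.
    rewrite -(wfix s A sin wA) test_opE mulmx_suml big1 // => o _.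
    have /negP := all0 o; rewrite negbK => /eqP o0.
    by rewrite ket_braM o0 scale0r.
  move/unit_vecE: uphi; rewrite phi0 dot0r => /eqP.
  by rewrite eq_sym oner_eq0.
have oA' A : 0 < wt s A -> o \in A.
  move=> wA; have := test_op_dot A o phi oA oB; rewrite wfix //.
  by case: (o \in A) => //; rewrite mul0r => /eqP; rewrite (negPf o0).
have fixo : ver_op [:: s] *m out_vec s o = out_vec s o.
  apply: ver_op_fix => // s' A [<-|//] wA.
  by apply: test_op_out_vec => //; apply: oA'.
have [d d0 /(_ (out_vec s o))] :=
  gap_bound uphi (adj_ver_op _) (valid_ver_op vs) gap.
rewrite fixo -/(nrm _); set w := out_vec s o - _ => gapo.
have : nrm w == 0.
  rewrite eq_le nrm_ge0 andbT -(pmulr_rle0 _ d0); move: gapo; lra.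
rewrite nrm_eq0 subr_eq0 => /eqP oE.
exists ((dot phi (out_vec s o))^-1 *: col o.1 (basisA s)), (col o.2 (basisB s)).
rewrite -scale_tens -/(out_vec s o) [in RHS]oE dotZr.
have k0 : dot phi (out_vec s o) != 0 by rewrite dotC cconj_eq0.
by rewrite scalerA (unit_vecE phi).1 // mulr1 mulVf // scale1r.
Qed.

(** Carries one test only: the whole weight sits on [A0], written with the boolean [A == A0] as a
    multiplicity. *)
Definition point_setting V W (A0 : {set 'I_2 * 'I_2}) (w : R) : lsetting R :=
  LSetting V W [ffun A => w *+ (A == A0)].

Lemma point_setting_wt V W A0 w : \sum_A wt (point_setting V W A0 w) A = w.
Proof.
rewrite (bigD1 A0) //= ffunE eqxx big1 ?addr0 // => A /negPf ne.
by rewrite ffunE ne.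
Qed.

Lemma point_setting_op V W A0 w :
  \sum_A cR (wt (point_setting V W A0 w) A) *: test_op (point_setting V W A0 w) A
  = cR w *: test_op (point_setting V W A0 w) A0.
Proof.
rewrite (bigD1 A0) //= ffunE eqxx big1 ?addr0 // => A /negPf ne.
by rewrite ffunE ne scale0r.
Qed.

Lemma point_setting_pos V W A0 w A :
  0 < wt (point_setting V W A0 w) A -> A = A0.
Proof. by rewrite ffunE; case: eqP => //=; rewrite ltxx. Qed.

Lemma point_setting_ge0 V W A0 w A : 0 <= w -> 0 <= wt (point_setting V W A0 w) A.
Proof. by move=> w0; rewrite ffunE mulrn_wge0. Qed.

Lemma onb2_completion (a : 'cV[C]_2) : unit_vec a ->
  exists2 V : 'M[C]_2, onb2 V & col 0 V = a.
Proof.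
have [x [y ->]] := cv2_ex a; move=> /unit_vecE; rewrite dot_cv2 => n1.
(* The second column, with entries [- cconj y] and [cconj x], is the unit vector orthogonal to [a],
   up to phase. *)
exists (\matrix_(i, j) nth 0 (nth [::] [:: [:: x; - cconj y]; [:: y; cconj x]] i) j);
  last by apply/colP => i; rewrite !mxE; case: i => [[|[|//]]].
apply/matrixP => i j; rewrite !mxE sum2 !mxE.
case: i j => [[|[|//]]] Hi [[|[|//]]] Hj /=; rewrite ?cconjN ?cconjK -?n1; ring.
Qed.

(** Measure each qubit in a basis starting with its normalized factor and accept only the first
    outcomes: the verification operator is then the projector onto [phi], with gap 1. *)
Lemma product_protocol (phi : 'cV[C]_(2 * 2)) : unit_vec phi -> product_state phi ->
  exists s, valid_state_protocol phi [:: s] /\ pos_spectral_gap phi (ver_op [:: s]).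
Proof.
move=> /unit_vecE uphi [a [b phiE]].
have ab1 : dot a a * dot b b = 1 by rewrite -dot_tens -phiE.
have a0 : a != 0 by apply: (@dot_neq0 _ _ a a); apply: contra_eq_neq ab1 => ->; rewrite mul0r eq_sym oner_eq0.
have b0 : b != 0 by apply: (@dot_neq0 _ _ b b); apply: contra_eq_neq ab1 => ->; rewrite mulr0 eq_sym oner_eq0.
have [k k0 uka] := normalize a0; have [l l0 ulb] := normalize b0.
have [V oV Va] := onb2_completion uka; have [W oW Wb] := onb2_completion ulb.
pose s := point_setting V W [set (0, 0)] 1.
have kbE : test_op s [set (0, 0)] = ket_bra phi.
  rewrite test_opE big_set1 /out_vec /= Va Wb -scale_tens -tens_scale -phiE.
  rewrite scalerA ket_braZ.
  move/unit_vecE: uka; move/unit_vecE: ulb; rewrite !dotZl !dotZr => eb ea.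
  have -> : cconj (k * l) * (k * l) = 1.
    rewrite -[LHS]mulr1 -{1}ab1 cconjM.
    transitivity ((cconj k * (k * dot a a)) * (cconj l * (l * dot b b))); first by ring.
    by rewrite ea eb mulr1.
  by rewrite scale1r.
have vE : ver_op [:: s] = ket_bra phi.
  by rewrite /ver_op big_seq1 point_setting_op kbE scale1r.
exists s; split; last first.
  exists 1; split=> // v pv; rewrite vE subrr mul0r -mulmxA ket_braM.
  by rewrite {1}/dot pv [X in X *: _]mxE scale0r mulmx0 mxE.
split; first by move=> s' [<-|].
split; first by move=> s' A [<-|//]; apply: point_setting_ge0.
split; last by rewrite big_seq1 point_setting_wt.
move=> s' A [<-|//] /point_setting_pos ->.
by rewrite kbE ket_braM uphi scale1r.
Qed.

Lemma out_vecE (s : lsetting R) o :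
  out_vec s o = col (mxtens_index o) (basisA s *t basisB s).
Proof.
by apply/colP => i; rewrite !mxE mxtens_indexK.
Qed.

(** The outcome vectors are the columns of the unitary [basisA s *t basisB s], so their projectors
    resolve the identity. *)
Lemma test_opT (s : lsetting R) : onb2 (basisA s) -> onb2 (basisB s) ->
  test_op s [set: _]%SET = 1%:M.
Proof.
move=> oA oB; set E := basisA s *t basisB s.
have EE : E *m adj E = 1%:M.
  apply: mulmx1C; rewrite /E adj_tens tensmx_mul oA oB.
  apply/matrixP => i j; rewrite -(mxtens_unindexK i) -(mxtens_unindexK j).
  move: (mxtens_unindex i) (mxtens_unindex j) => [i1 i2] [j1 j2].
  rewrite !mxE (inj_eq (can_inj (@mxtens_indexK 2 2))) !mxtens_indexK /= xpair_eqE.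
  by rewrite -natrM mulnb.
rewrite test_opE -EE; apply/matrixP => i j; rewrite summxE mxE sum_mxtens pair_big.
apply: eq_big => [o|o _]; first by rewrite inE.
by rewrite out_vecE /ket_bra mxE big_ord1 !mxE; case: o.
Qed.

Lemma test_opC (s : lsetting R) A : onb2 (basisA s) -> onb2 (basisB s) ->
  test_op s (~: A) = 1%:M - test_op s A.
Proof.
move=> oA oB; rewrite -(test_opT oA oB).
suff -> : test_op s [set: _]%SET = test_op s A + test_op s (~: A) by rewrite addrAC subrr add0r.
rewrite {1}/test_op (bigID (mem A)) /=.
by congr (_ + _); apply: eq_bigl => o; rewrite !inE.
Qed.

Lemma dot_test_op (s : lsetting R) A v :
  dot v (test_op s A *m v) = cR (\sum_(o in A) sqmod (dot (out_vec s o) v)).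
Proof.
rewrite test_opE mulmx_suml cR_sum /dot mulmx_sumr summxE; apply: eq_bigr => o _.
by rewrite ket_braM -/(dot v _) dotZr sqmodE (dotC _ v) mulrC.
Qed.

(** The outcome vector [out_vec] in terms of the bases alone, without the weights of a setting. *)
Definition kron_vec (V W : 'M[C]_2) (o : 'I_2 * 'I_2) : 'cV[C]_(2 * 2) :=
  col o.1 V *t col o.2 W.

Lemma reject_setting V W A0 w v : onb2 V -> onb2 W ->
  dot v ((\sum_A cR (wt (point_setting V W (~: A0) w) A) *:
    test_op (point_setting V W (~: A0) w) A) *m v) =
  cR (w * (nrm v - \sum_(o in A0) sqmod (dot (kron_vec V W o) v))).
Proof.
move=> oV oW; rewrite point_setting_op test_opC // -scalemxAl dotZr mulmxBl mul1mx.
by rewrite dotBr dot_nrm dot_test_op -cRB -cRM.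
Qed.

Lemma reject_fix V W (A0 : {set 'I_2 * 'I_2}) w phi : onb2 V -> onb2 W ->
  \sum_(o in A0) sqmod (dot (kron_vec V W o) phi) = 0 ->
  test_op (point_setting V W (~: A0) w) (~: A0) *m phi = phi.
Proof.
move=> oV oW /eqP; rewrite psumr_eq0 => [/allP s0|o _]; last exact: sqmod_ge0.
rewrite test_opC // mulmxBl mul1mx test_opE mulmx_suml big1 ?subr0 // => o oinA.
have := s0 o; rewrite mem_index_enum oinA sqmod_eq0 => /(_ isT)/eqP o0.
by rewrite ket_braM o0 scale0r.
Qed.

Lemma half_sum (x a b : R) :
  2^-1 * (x - a) + 2^-1 * (x - b) = x - 2^-1 * a - 2^-1 * b.
Proof. by field. Qed.

Lemma ver_op_pair (s1 s2 : lsetting R) v : dot v (ver_op [:: s1; s2] *m v) =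
  dot v ((\sum_A cR (wt s1 A) *: test_op s1 A) *m v) +
  dot v ((\sum_A cR (wt s2 A) *: test_op s2 A) *m v).
Proof. by rewrite /ver_op big_cons big_seq1 mulmxDl dotDr. Qed.

(** Each of the two settings is used with probability one half and rejects only outcomes in [A1],
    respectively [A2], which [phi] never produces. *)
Lemma reject_protocol V1 W1 (A1 : {set 'I_2 * 'I_2}) V2 W2 (A2 : {set 'I_2 * 'I_2}) phi :
  onb2 V1 -> onb2 W1 -> onb2 V2 -> onb2 W2 ->
  \sum_(o in A1) sqmod (dot (kron_vec V1 W1 o) phi) = 0 ->
  \sum_(o in A2) sqmod (dot (kron_vec V2 W2 o) phi) = 0 ->
  exists s1 s2, valid_state_protocol phi [:: s1; s2] /\
    forall v, dot v (ver_op [:: s1; s2] *m v) =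
      cR (nrm v - 2^-1 * \sum_(o in A1) sqmod (dot (kron_vec V1 W1 o) v)
                - 2^-1 * \sum_(o in A2) sqmod (dot (kron_vec V2 W2 o) v)).
Proof.
move=> oV1 oW1 oV2 oW2 phi1 phi2.
exists (point_setting V1 W1 (~: A1) 2^-1), (point_setting V2 W2 (~: A2) 2^-1).
split=> [|v]; last first.
  apply: etrans (ver_op_pair _ _ _) _.
  apply: etrans (congr2 +%R (reject_setting A1 2^-1 v oV1 oW1)
    (reject_setting A2 2^-1 v oV2 oW2)) _.
  by rewrite -cRD; move: (nrm v) => x; congr cR; exact: half_sum.
split; first by move=> s' [<-|[<-|]].
split.
  by move=> s' A [<-|[<-|//]]; apply: point_setting_ge0; rewrite invr_ge0 ler0n.
split; last by rewrite !big_cons big_nil !point_setting_wt; field.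
by move=> s' A [<-|[<-|//]] /point_setting_pos ->; exact: reject_fix.
Qed.

(* The second setting rejects a single product vector orthogonal to the state
   but not to the singlet-like vector [cv4 0 (- z^* ) y^* 0] that passes the
   first one. *)
Lemma two_setting_protocol (y z : C) : sqmod y + sqmod z = 1 ->
  exists s1 s2, valid_state_protocol (cv4 0 y z 0) [:: s1; s2] /\
    pos_spectral_gap (cv4 0 y z 0) (ver_op [:: s1; s2]).
Proof.
move=> yz1; set phi := cv4 0 y z 0.
have yzC : cconj y * y + cconj z * z = 1 by rewrite -!sqmodE -cRD yz1.
pose h : C := cR (Num.sqrt 2^-1).
have hh : h * h = 2^-1.
  by rewrite -cRM -expr2 sqr_sqrtr ?invr_ge0 ?ler0n // cRV cR_nat.
have h2 : sqmod h = 2^-1.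
  by rewrite /sqmod /= expr0n addr0 sqr_sqrtr ?invr_ge0 ?ler0n.
have hJ : cconj h = h by apply: cconj_cR.
(* The product of these two unit vectors is the one rejected by the second setting; its overlap with
   [phi] is proportional to [- z * y + y * z], which vanishes. *)
have uu : unit_vec (cv2 h h).
  by apply/unit_vecE; rewrite dot_cv2 hJ hh; field.
have uv : unit_vec (cv2 (cconj y) (- cconj z)).
  by apply/unit_vecE; rewrite dot_cv2 cconjN !cconjK -yzC; ring.
have [V oV Va] := onb2_completion uu; have [W oW Wb] := onb2_completion uv.
have o1 : onb2 (1%:M : 'M[C]_2) by rewrite /onb2 adj1 mulmx1.
pose A1 : {set 'I_2 * 'I_2} := [set (0, 0); (1, 1)].
pose A2 : {set 'I_2 * 'I_2} := [set (0, 0)].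
have e00 : kron_vec 1%:M 1%:M (0, 0) = cv4 1 0 0 0.
  rewrite /kron_vec /=; have -> : col 0 1%:M = cv2 1 0 :> 'cV[C]_2.
    by apply/colP => i; rewrite !mxE; case: i => [[|[|//]]].
  by rewrite tens_cv2 !(mulr0, mul0r, mulr1).
have e11 : kron_vec 1%:M 1%:M (1, 1) = cv4 0 0 0 1.
  rewrite /kron_vec /=; have -> : col 1 1%:M = cv2 0 1 :> 'cV[C]_2.
    by apply/colP => i; rewrite !mxE; case: i => [[|[|//]]].
  by rewrite tens_cv2 !(mulr0, mul0r, mulr1).
have euv : kron_vec V W (0, 0) = cv4 (h * cconj y) (- (h * cconj z))
    (h * cconj y) (- (h * cconj z)).
  by rewrite /kron_vec /= Va Wb tens_cv2 !mulrN.
have d1 a b c d : \sum_(o in A1) sqmod (dot (kron_vec 1%:M 1%:M o) (cv4 a b c d)) =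
    sqmod a + sqmod d.
  rewrite big_setU1 ?inE // big_set1 e00 e11 !dot_cv4 !cconj0 !cconj1.
  by rewrite !mul0r !mul1r !addr0 !add0r.
have d2 a b c d : \sum_(o in A2) sqmod (dot (kron_vec V W o) (cv4 a b c d)) =
    2^-1 * sqmod (y * a - z * b + y * c - z * d).
  rewrite big_set1 euv dot_cv4 !cconjN !cconjM !cconjK hJ -h2 -sqmodM.
  by congr sqmod; ring.
have s00 : sqmod (0 : C) = 0 by apply/eqP; rewrite sqmod_eq0.
have phi1 : \sum_(o in A1) sqmod (dot (kron_vec 1%:M 1%:M o) phi) = 0.
  by rewrite d1 s00 addr0.
have phi2 : \sum_(o in A2) sqmod (dot (kron_vec V W o) phi) = 0.
  rewrite d2 (_ : _ + _ - _ = 0) ?s00 ?mulr0 //; ring.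
have [s1 [s2 [vs vop]]] := reject_protocol o1 o1 oV oW phi1 phi2.
exists s1, s2; split=> //.
(* Write [A], [D], [K] for the squared moduli of [a], [d], [k] and [m] for that of [q + k], with [k]
   and [q] as introduced below. The rejection probability is [(A + D) / 2 + m / 4], while the
   squared norm is [A + D + K] and [K <= 2 * m + 2 * (A + D)]; one eighth suffices. *)
exists 8^-1; split; first by rewrite invr_gt0 ltr0n.
move=> v; have [a [b [c [d ->]]]] := cv4_ex v.
set v' := cv4 a b c d => pv.
have orth : cconj y * b + cconj z * c = 0.
  have := congr1 (fun M : 'M_1 => M 0 0) pv; rewrite -/(dot phi v') dot_cv4 mxE.
  by rewrite cconj0 !mul0r add0r addr0.
rewrite -mulmxA -/(dot _ _) -/(dot v' v') -/(nrm v').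
rewrite vop /v' d1 d2 nrm_cv4 -[complex.Re _]/(_ - _ - _).
(* On the middle two coordinates the orthogonal complement of [phi] is a line, and [k] is the
   amplitude along it. *)
pose k := y * c - z * b.
have bE : b = - (cconj z * k).
  rewrite -[LHS]mulr1 -yzC /k.
  transitivity (y * (cconj y * b + cconj z * c) - cconj z * (y * c - z * b)); first by ring.
  by rewrite orth mulr0 sub0r.
have cE : c = cconj y * k.
  rewrite -[LHS]mulr1 -yzC /k.
  transitivity (z * (cconj y * b + cconj z * c) + cconj y * (y * c - z * b)); first by ring.
  by rewrite orth mulr0 add0r.
have -> : y * a - z * b + y * c - z * d = (y * a - z * d) + k by rewrite /k; ring.
have -> : sqmod b = sqmod z * sqmod k.
  by rewrite bE /sqmod; case: (z) (k) => ? ? [? ?] /=; ring.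
have -> : sqmod c = sqmod y * sqmod k by rewrite cE sqmodM sqmod_conj.
set q := y * a - z * d.
(* Cauchy-Schwarz, through the explicit remainder of the Lagrange identity. *)
have q_le : sqmod q <= sqmod a + sqmod d.
  rewrite -[leRHS]mul1r -yz1 -subr_ge0.
  have -> : (sqmod y + sqmod z) * (sqmod a + sqmod d) - sqmod q =
    sqmod (cconj z * a + cconj y * d).
    by rewrite /q /sqmod; case: (y) (z) (a) (d) => ? ? [? ?] [? ?] [? ?] /=; ring.
  exact: sqmod_ge0.
(* The parallelogram law for [q + k] and [q]. *)
have k_le : sqmod k <= 2 * sqmod (q + k) + 2 * sqmod q.
  rewrite -subr_ge0.
  have -> : 2 * sqmod (q + k) + 2 * sqmod q - sqmod k = sqmod (2 * q + k).
    by rewrite /sqmod; case: (q) (k) => ? ? [? ?] /=; ring.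
  exact: sqmod_ge0.
have := sqmod_ge0 a; have := sqmod_ge0 d; have := sqmod_ge0 (q + k).
have -> : sqmod a + sqmod z * sqmod k + sqmod y * sqmod k + sqmod d =
  sqmod a + (sqmod y + sqmod z) * sqmod k + sqmod d by ring.
rewrite yz1 mul1r; move: q_le k_le; move: (sqmod a) (sqmod d) (sqmod k) (sqmod q).
move: (sqmod (q + k)) => m A D K Q; clear; lra.
Qed.

End StateProtocols.

(** * The canonical gate is diagonal in the Bell basis *)

Section CanonicalGate.
Variable R : realType.
Local Notation C := R[i].

(* [w1, w2] are the eigenvalues on (|00> + |11>, |00> - |11>) and [w3, w4]
   those on (|01> + |10>, |01> - |10>). *)
Definition bell_diag (w1 w2 w3 w4 : C) : 'M[C]_(2 * 2) :=
  \matrix_(i, j) nth 0 (nth [::]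
    [:: [:: (w1 + w2) / 2; 0; 0; (w1 - w2) / 2];
        [:: 0; (w3 + w4) / 2; (w3 - w4) / 2; 0];
        [:: 0; (w3 - w4) / 2; (w3 + w4) / 2; 0];
        [:: (w1 - w2) / 2; 0; 0; (w1 + w2) / 2]] i) j.

Lemma bell_diagM w1 w2 w3 w4 v1 v2 v3 v4 :
  bell_diag w1 w2 w3 w4 *m bell_diag v1 v2 v3 v4 =
  bell_diag (w1 * v1) (w2 * v2) (w3 * v3) (w4 * v4).
Proof.
apply/matrixP => i j; rewrite mxE sum4 !mxE.
case: i => [[|[|[|[|//]]]]] Hi; case: j => [[|[|[|[|//]]]]] Hj /=; by field.
Qed.

Lemma bell_diag1 : bell_diag 1 1 1 1 = 1%:M.
Proof.
apply/matrixP => i j; rewrite !mxE.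
case: i => [[|[|[|[|//]]]]] Hi; case: j => [[|[|[|[|//]]]]] Hj /=; by field.
Qed.

Lemma adj_bell_diag w1 w2 w3 w4 : adj (bell_diag w1 w2 w3 w4) =
  bell_diag (cconj w1) (cconj w2) (cconj w3) (cconj w4).
Proof.
apply/matrixP => i j; rewrite !mxE.
case: i => [[|[|[|[|//]]]]] Hi; case: j => [[|[|[|[|//]]]]] Hj /=;
  rewrite ?cconj0 ?cconjM ?cconjD ?cconjN ?cconjV ?cconj_nat //.
Qed.

Lemma bell_diagX w1 w2 w3 w4 k : bell_diag w1 w2 w3 w4 ^+ k =
  bell_diag (w1 ^+ k) (w2 ^+ k) (w3 ^+ k) (w4 ^+ k).
Proof.
elim: k => [|k IH]; first by rewrite !expr0 bell_diag1.
by rewrite !exprS IH -bell_diagM.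
Qed.

(** Since the coefficients are real, real and imaginary parts of entries, and hence the limits in
    [is_mexp], reduce to those of the eigenvalues. *)
Lemma bell_diag_entry i j : exists c1 c2 c3 c4 : R, forall w1 w2 w3 w4,
  bell_diag w1 w2 w3 w4 i j = cR c1 * w1 + cR c2 * w2 + cR c3 * w3 + cR c4 * w4.
Proof.
have h : cR 2^-1 = 2^-1 :> C by rewrite cRV cR_nat.
have h' : cR (- 2^-1) = - 2^-1 :> C by rewrite -[- _]sub0r cRB h cR0 sub0r.
case: i => [[|[|[|[|//]]]]] Hi; case: j => [[|[|[|[|//]]]]] Hj;
  try (exists 0, 0, 0, 0 => *; rewrite mxE /= cR0; by ring);
  try (exists 2^-1, 2^-1, 0, 0 => *; rewrite mxE /= cR0 h; by field);
  try (exists 2^-1, (- 2^-1), 0, 0 => *; rewrite mxE /= cR0 h h'; by field);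
  try (exists 0, 0, 2^-1, 2^-1 => *; rewrite mxE /= cR0 h; by field);
  try (exists 0, 0, 2^-1, (- 2^-1) => *; rewrite mxE /= cR0 h h'; by field).
Qed.

Definition phase (x : R) : C := - cI R * cR x.

(** The Bell vectors are joint eigenvectors of the three operators [sigma1 *t sigma1],
    [sigma2 *t sigma2], [sigma3 *t sigma3], with eigenvalues 1 or -1; these give the signs. *)
Lemma canonH_bell_diag (a1 a2 a3 : R) : - cI R *: canonH a1 a2 a3 =
  bell_diag (phase (a1 - a2 + a3)) (phase (a2 - a1 + a3))
            (phase (a1 + a2 - a3)) (phase (- a1 - a2 - a3)).
Proof.
have cRN (x : R) : cR (- x) = - cR x :> C by rewrite -sub0r cRB sub0r.
apply/matrixP => i j; rewrite /phase !mxE !cRD !cRN.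
case: i => [[|[|[|[|//]]]]] Hi; case: j => [[|[|[|[|//]]]]] Hj /=;
  rewrite ?(mulrNN, mulNr, mulrN) ?cI2; by field.
Qed.

(** This is exp(-ix), with the sign of the gate rather than the customary exp(ix). *)
Definition cis (x : R) : C := Complex (cos x) (- sin x).

(** Powers of -i have period 4: the parity of [k] separates the cosine from the sine series, and
    [k./2] gives the sign. *)
Lemma phaseX x k : phase x ^+ k =
  (if odd k then - cI R else 1) * cR ((-1) ^+ k./2 * x ^+ k).
Proof.
rewrite /phase exprMn_comm; last exact: mulrC.
have -> : cR x ^+ k = cR (x ^+ k) by rewrite -(rmorphXn (real_complex R)).
rewrite cRM mulrA; congr (_ * _).
rewrite -{1}(odd_double_half k) exprD -mul2n exprM sqrrN expr2 cI2.
have -> : cR ((-1) ^+ k./2) = (-1) ^+ k./2 :> C.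
  by rewrite -[cR _]/(real_complex R _) rmorphXn rmorphN1.
by case: odd; rewrite ?expr1 ?expr0.
Qed.

Lemma Re_exp_term x k :
  complex.Re (cR (k`!%:R)^-1 * phase x ^+ k) = cos_coeff x k.
Proof.
rewrite Re_cRM phaseX /cos_coeff /=.
by case: (odd k) => /=; rewrite ?exprnP; field; rewrite pnatr_eq0 -lt0n fact_gt0.
Qed.

Lemma Im_exp_term x k :
  complex.Im (cR (k`!%:R)^-1 * phase x ^+ k) = - sin_coeff x k.
Proof.
have ImM (r : R) (z : C) : complex.Im (cR r * z) = r * complex.Im z.
  by case: z => a b /=; rewrite mul0r addr0.
rewrite ImM phaseX /sin_coeff /=.
case: k => [|k] /=; first by rewrite !(mul0r, mulr0, addr0, oppr0).
rewrite ?uphalf_half.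
by case: (boolP (odd k)) => /= ok; rewrite ?add0n ?exprnP; field; rewrite pnatr_eq0 -lt0n fact_gt0.
Qed.

Local Open Scope classical_set_scope.
Import numFieldNormedType.Exports.

Definition exp_sum (x : R) (N : nat) : C :=
  \sum_(k < N) cR (k`!%:R)^-1 * phase x ^+ k.

Lemma exp_sum_cvg x :
  (complex.Re (exp_sum x N) @[N --> \oo] --> complex.Re (cis x)) /\
  (complex.Im (exp_sum x N) @[N --> \oo] --> complex.Im (cis x)).
Proof.
have Im_sum n (F : 'I_n -> C) :
    complex.Im (\sum_k F k) = \sum_k complex.Im (F k).
  apply: (big_morph _ _ (erefl : complex.Im (0 : C) = 0)).
  by move=> [? ?] [? ?].
split.
  rewrite [X in X @ _ --> _](_ : _ = series (cos_coeff x)).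
    by rewrite /= unlock; exact: is_cvg_series_cos_coeff.
  apply/funext => N; rewrite /exp_sum Re_sum seriesEord.
  by apply: eq_bigr => k _; rewrite Re_exp_term.
rewrite [X in X @ _ --> _](_ : _ = - series (sin_coeff x)).
  by rewrite /= unlock; apply: cvgN; exact: is_cvg_series_sin_coeff.
apply/funext => N; rewrite /exp_sum Im_sum seriesEord fctE -sumrN.
by apply: eq_bigr => k _; rewrite Im_exp_term.
Qed.

(** Powers act on the eigenvalues, so each partial matrix sum is the Bell-diagonal matrix of the
    scalar partial sums. *)
Lemma mexp_bell_diag x1 x2 x3 x4 :
  is_mexp (bell_diag (phase x1) (phase x2) (phase x3) (phase x4))
          (bell_diag (cis x1) (cis x2) (cis x3) (cis x4)).
Proof.
move=> i j; have [c1 [c2 [c3 [c4 cE]]]] := bell_diag_entry i j.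
have ReE w1 w2 w3 w4 : complex.Re (bell_diag w1 w2 w3 w4 i j) =
    c1 * complex.Re w1 + c2 * complex.Re w2 + c3 * complex.Re w3 + c4 * complex.Re w4.
  by rewrite cE !ReD !Re_cRM.
have ImE w1 w2 w3 w4 : complex.Im (bell_diag w1 w2 w3 w4 i j) =
    c1 * complex.Im w1 + c2 * complex.Im w2 + c3 * complex.Im w3 + c4 * complex.Im w4.
  by rewrite cE; case: w1 w2 w3 w4 => ? ? [? ?] [? ?] [? ?] /=; ring.
have sumE N : (\sum_(k < N) cR (k`!%:R)^-1 *:
      bell_diag (phase x1) (phase x2) (phase x3) (phase x4) ^+ k) i j =
    bell_diag (exp_sum x1 N) (exp_sum x2 N) (exp_sum x3 N) (exp_sum x4 N) i j.
  rewrite summxE cE /exp_sum !mulr_sumr -!big_split; apply: eq_bigr => k _.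
  by rewrite mxE bell_diagX cE /=; ring.
have [r1 i1] := exp_sum_cvg x1; have [r2 i2] := exp_sum_cvg x2.
have [r3 i3] := exp_sum_cvg x3; have [r4 i4] := exp_sum_cvg x4.
split.
  rewrite ReE [X in X @ _ --> _](_ : _ = fun N => c1 * complex.Re (exp_sum x1 N) +
    c2 * complex.Re (exp_sum x2 N) + c3 * complex.Re (exp_sum x3 N) +
    c4 * complex.Re (exp_sum x4 N)).
    by do 3?[apply: cvgD]; apply: cvgM => //; exact: cvg_cst.
  by apply/funext => N; rewrite -ReE; congr complex.Re; exact: sumE.
  rewrite ImE [X in X @ _ --> _](_ : _ = fun N => c1 * complex.Im (exp_sum x1 N) +
    c2 * complex.Im (exp_sum x2 N) + c3 * complex.Im (exp_sum x3 N) +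
    c4 * complex.Im (exp_sum x4 N)).
    by do 3?[apply: cvgD]; apply: cvgM => //; exact: cvg_cst.
  by apply/funext => N; rewrite -ImE; congr complex.Im; exact: sumE.
Qed.

Lemma mexp_unique n (A E F : 'M[C]_n) : is_mexp A E -> is_mexp A F -> E = F.
Proof.
move=> AE AF; apply/matrixP => i j; have [rE iE] := AE i j; have [rF iF] := AF i j.
apply/eqP; rewrite eq_complex; apply/andP; split; apply/eqP.
  exact: (cvg_unique (@Rhausdorff R) rE rF).
exact: (cvg_unique (@Rhausdorff R) iE iF).
Qed.

Lemma canonU_bell_diag (a1 a2 a3 : R) U : is_canonU a1 a2 a3 U ->
  U = bell_diag (cis (a1 - a2 + a3)) (cis (a2 - a1 + a3))
                (cis (a1 + a2 - a3)) (cis (- a1 - a2 - a3)).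
Proof.
rewrite /is_canonU canonH_bell_diag => /mexp_unique; apply.
exact: mexp_bell_diag.
Qed.

End CanonicalGate.

(** * Coincidences among the squared eigenvalues *)

Section Phases.
Variable R : realType.
Local Notation C := R[i].

Lemma sqmod_cis (x : R) : sqmod (cis x) = 1.
Proof. by rewrite /sqmod /= sqrrN cos2Dsin2. Qed.

Lemma cis_sqr_eq (x y : R) : cis x ^+ 2 = cis y ^+ 2 -> sin (x - y) = 0.
Proof.
move/eqP; rewrite eqf_sqr sinB !eq_complex /= => /orP[] /andP[/eqP ec /eqP es].
  by rewrite ec (oppr_inj es) mulrC subrr.
have -> := oppr_inj es.
by rewrite ec; ring.
Qed.

Lemma sin_eq0_pi (x : R) : 0 <= x -> x <= pi -> sin x = 0 -> x = 0 \/ x = pi.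
Proof.
rewrite le_eqVlt => /predU1P[->|x0]; first by left.
rewrite le_eqVlt => /predU1P[->|xpi]; first by right.
move=> s0; have : 0 < sin x by apply: sin_gt0_pi; rewrite x0 xpi.
by rewrite s0 ltxx.
Qed.

Lemma cisDpi (x : R) : cis (x + pi) = - cis x.
Proof. by apply/eqP; rewrite eq_complex /= cosDpi sinDpi !eqxx. Qed.

(** The first three angles equal [a1] and the fourth is [- 3 * a1]; they differ by [4 * a1],
    strictly between 0 and [pi]. *)
Lemma inSE_phases (a1 a2 a3 : R) : inSE a1 a2 a3 ->
  [/\ cis (a1 - a2 + a3) = cis (a1 + a2 - a3),
      cis (a2 - a1 + a3) = cis (a1 + a2 - a3) &
      cis (a1 + a2 - a3) ^+ 2 <> cis (- a1 - a2 - a3) ^+ 2].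
Proof.
move=> [<- [<- [a0 api]]]; split; [congr cis; ring | congr cis; ring |].
move/cis_sqr_eq; have -> : a1 + a1 - a1 - (- a1 - a1 - a1) = 4 * a1 by ring.
case/sin_eq0_pi; [lra | lra | lra |].
by move=> e; move: api; rewrite -e mulrAC divff ?mul1r ?ltxx // pnatr_eq0.
Qed.

(** In the chamber all relevant angle differences lie between 0 and [pi], so a coincidence of
    squares puts the difference at an endpoint. Three coincident squares then force equal
    parameters, and the corners 0 and [pi / 4] make all four squares coincide. *)
Lemma inSEF_phases (a1 a2 a3 : R) : inSEF a1 a2 a3 ->
  let W1 := cis (a1 - a2 + a3) ^+ 2 in let W2 := cis (a2 - a1 + a3) ^+ 2 in
  let W3 := cis (a1 + a2 - a3) ^+ 2 in let W4 := cis (- a1 - a2 - a3) ^+ 2 in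
  (W3 = W4 /\ W1 = W2) \/
  [/\ W3 <> W4, ~ (W1 = W2 /\ W1 = W3) & ~ (W1 = W2 /\ W1 = W4)].
Proof.
move=> [[a30 [a32 [a21 a1pi]]] nSE] /=.
have p0 : 0 < pi :> R := pi_gt0 R.
have eq12 : cis (a1 - a2 + a3) ^+ 2 = cis (a2 - a1 + a3) ^+ 2 -> a1 = a2.
  move/cis_sqr_eq; have -> : a1 - a2 + a3 - (a2 - a1 + a3) = 2 * (a1 - a2) by ring.
  by case/sin_eq0_pi; lra.
have [e34|ne34] := pselect (cis (a1 + a2 - a3) ^+ 2 = cis (- a1 - a2 - a3) ^+ 2).
  (* Here [2 * (a1 + a2)] is 0 or [pi], so both parameters are 0 or both are [pi / 4]. *)
  left; split=> //; have a12 : a1 = a2.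
    move/cis_sqr_eq: e34.
    have -> : a1 + a2 - a3 - (- a1 - a2 - a3) = 2 * (a1 + a2) by ring.
    by case/sin_eq0_pi; lra.
  by rewrite a12 subrr.
right; split=> // -[e12 e].
  have a12 := eq12 e12; apply: nSE; rewrite a12 in e ne34 a1pi *.
  have a23 : a2 = a3.
    move/esym/cis_sqr_eq: e.
    have -> : a2 + a2 - a3 - (a2 - a2 + a3) = 2 * (a2 - a3) by ring.
    by case/sin_eq0_pi; lra.
  rewrite -a23 in ne34 a30; split=> //; split=> //; split.
    rewrite lt_neqAle a30 andbT; apply/eqP => a0.
    by apply: ne34; rewrite -a0 !(subr0, addr0, oppr0).
  rewrite lt_neqAle a1pi andbT; apply/eqP => a0; apply: ne34.
  (* At the corner [pi / 4] the two angles differ by [pi], which only changes the sign before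
     squaring. *)
  have -> : a2 + a2 - a2 = (- a2 - a2 - a2) + pi by lra.
  by rewrite cisDpi sqrrN.
have a12 := eq12 e12; apply: ne34; rewrite a12 in e a1pi *.
move/cis_sqr_eq: e.
have -> : a2 - a2 + a3 - (- a2 - a2 - a3) = 2 * (a2 + a3) by ring.
case/sin_eq0_pi; [lra | lra | |] => h.
  have -> : a2 = 0 by lra.
  have -> : a3 = 0 by lra.
  by rewrite !(subr0, addr0, oppr0).
have -> : a3 = a2 by lra.
have -> : a2 + a2 - a2 = (- a2 - a2 - a2) + pi by lra.
by rewrite cisDpi sqrrN.
Qed.

(** Strict convexity of the disc: the midpoint of a chord lies on the unit circle only if the chord
    is degenerate. *)
Lemma sqmod_midpoint (a b c : C) :
  sqmod a = 1 -> sqmod b = 1 -> sqmod c = 1 -> a + b = 2 * c -> a = b /\ a = c.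
Proof.
move=> ua ub uc abc.
have aE : a = 2 * c - b by rewrite -abc addrK.
have bc : b = c.
  apply/eqP; rewrite eq_sym -subr_eq0 -sqmod_eq0; apply/eqP.
  have -> : sqmod (c - b) = (sqmod a + sqmod b) / 2 - sqmod c.
    by rewrite aE /sqmod; case: (c) (b) => ? ? [? ?] /=; field.
  by rewrite ua ub uc; field.
by rewrite bc in aE *; have -> : a = c by [rewrite aE; ring]; split.
Qed.

End Phases.

(** * Product outputs and protocols built from four inputs *)

Section GateProtocols.
Variable R : realType.
Local Notation C := R[i].

(** The two-by-two matrix of amplitudes has rank at most one iff its determinant vanishes. *)
Lemma product_cv4 (a b c d : C) : product_state (cv4 a b c d) <-> a * d = b * c.
Proof.
split=> [[x [y]]|abcd].
  have [x0 [x1 ->]] := cv2_ex x; have [y0 [y1 ->]] := cv2_ex y.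
  rewrite tens_cv2 => /colP e.
  have := e (mxtens_index (0, 0)); have := e (mxtens_index (0, 1)).
  have := e (mxtens_index (1, 0)); have := e (mxtens_index (1, 1)).
  by rewrite !mxE /= => -> -> -> ->; ring.
have [a0|a0] := eqVneq a 0; last first.
  exists (cv2 1 (c / a)), (cv2 a b); rewrite tens_cv2 !mul1r divfK //.
  have -> // : c / a * b = d by apply: (mulfI a0); rewrite abcd; field.
have : b * c == 0 by rewrite -abcd a0 mul0r.
rewrite a0 mulf_eq0 => /orP[] /eqP ->.
  by exists (cv2 0 1), (cv2 c d); rewrite tens_cv2 !(mul0r, mul1r).
by exists (cv2 b d), (cv2 0 1); rewrite tens_cv2 !(mulr0, mulr1).
Qed.

Lemma product_state_scale (k : C) v : product_state v -> product_state (k *: v).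
Proof. by move=> [a [b ->]]; exists (k *: a), b; rewrite scale_tens. Qed.

Lemma bell_diag_cv4 (w1 w2 w3 w4 a b c d : C) :
  bell_diag w1 w2 w3 w4 *m cv4 a b c d =
  cv4 ((w1 * (a + d) + w2 * (a - d)) / 2) ((w3 * (b + c) + w4 * (b - c)) / 2)
      ((w3 * (b + c) - w4 * (b - c)) / 2) ((w1 * (a + d) - w2 * (a - d)) / 2).
Proof.
apply/colP => i; rewrite !mxE sum4 !mxE.
by case: i => [[|[|[|[|//]]]]] Hi /=; field.
Qed.

(** Four times the determinant criterion, in the Bell amplitudes [a + d], [a - d], [b + c], [b - c]
    multiplied by their eigenvalues. *)
Lemma bell_diag_product (w1 w2 w3 w4 a b c d : C) :
  product_state (bell_diag w1 w2 w3 w4 *m cv4 a b c d) <->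
  w1 ^+ 2 * (a + d) ^+ 2 - w2 ^+ 2 * (a - d) ^+ 2 =
  w3 ^+ 2 * (b + c) ^+ 2 - w4 ^+ 2 * (b - c) ^+ 2.
Proof.
rewrite bell_diag_cv4; split=> [/product_cv4 e|e]; last first.
  apply/product_cv4.
  transitivity ((w1 ^+ 2 * (a + d) ^+ 2 - w2 ^+ 2 * (a - d) ^+ 2) / 4); first by field.
  by rewrite e; field.
transitivity (4 * ((w1 * (a + d) + w2 * (a - d)) / 2 *
                   ((w1 * (a + d) - w2 * (a - d)) / 2))); first by field.
by rewrite e; field.
Qed.

Lemma bell_diag_unitary (w1 w2 w3 w4 : C) :
  sqmod w1 = 1 -> sqmod w2 = 1 -> sqmod w3 = 1 -> sqmod w4 = 1 ->
  adj (bell_diag w1 w2 w3 w4) *m bell_diag w1 w2 w3 w4 = 1%:M.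
Proof.
by move=> u1 u2 u3 u4; rewrite adj_bell_diag bell_diagM -!sqmodE u1 u2 u3 u4 bell_diag1.
Qed.

(** The scalar [k] allows inputs to be given by unnormalized vectors; [n] counts the settings spent
    on the test. *)
Definition testable (U : 'M[C]_(2 * 2)) n psi (t : gate_test R) : Prop :=
  [/\ exists2 k : C, k != 0 & in_state t = k *: psi,
      unit_vec (inA t) /\ unit_vec (inB t),
      valid_state_protocol (U *m in_state t) (out_prot t),
      pos_spectral_gap (U *m in_state t) (ver_op (out_prot t)) &
      size (out_prot t) = n].

Lemma testable_product U (a b : 'cV[C]_2) : adj U *m U = 1%:M ->
  a != 0 -> b != 0 -> product_state (U *m (a *t b)) ->
  exists t, testable U 1 (a *t b) t.
Proof.
move=> uU a0 b0 pU; have [k k0 uka] := normalize a0; have [l l0 ulb] := normalize b0.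
have inE' : (k *: a) *t (l *: b) = (k * l) *: (a *t b) :> 'cV[C]_(2 * 2).
  by rewrite -scale_tens -tens_scale scalerA.
have uphi : unit_vec (U *m ((k *: a) *t (l *: b))).
  apply/unit_vecE; rewrite dotMr mulmxA uU mul1mx dot_tens.
  by move/unit_vecE: uka => ->; move/unit_vecE: ulb => ->; rewrite mulr1.
have pphi : product_state (U *m ((k *: a) *t (l *: b))).
  by rewrite inE' -scalemxAr; apply: product_state_scale.
have [s [vs gs]] := product_protocol uphi pphi.
exists (GateTest (k *: a) (l *: b) [:: s]); split=> //.
by exists (k * l); [rewrite mulf_neq0 | exact: inE'].
Qed.

(** Form of [star_verifies] used for explicit inputs: [p0] is the centre, and spanning is expressed
    by a trivial orthogonal complement. *)
Lemma star_protocol U n0 n1 n2 n3 (p0 p1 p2 p3 : 'cV[C]_(2 * 2)) :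
  adj U *m U = 1%:M ->
  (exists t, testable U n0 p0 t) -> (exists t, testable U n1 p1 t) ->
  (exists t, testable U n2 p2 t) -> (exists t, testable U n3 p3 t) ->
  dot p0 p1 != 0 -> dot p0 p2 != 0 -> dot p0 p3 != 0 ->
  (forall v, dot v p0 = 0 -> dot v p1 = 0 -> dot v p2 = 0 -> dot v p3 = 0 -> v = 0) ->
  exists G, [/\ valid_gate_protocol U G, ordinary U G, verifies U G,
    num_settings G = (n0 + n1 + n2 + n3)%N &
    forall t, List.In t G -> exists k, [\/ in_state t = k *: p0,
      in_state t = k *: p1, in_state t = k *: p2 | in_state t = k *: p3]].
Proof.
move=> uU [t0 T0] [t1 T1] [t2 T2] [t3 T3] d1 d2 d3 span.
have allG (P : gate_test R -> Prop) : P t0 -> P t1 -> P t2 -> P t3 ->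
    forall t, List.In t [:: t0; t1; t2; t3] -> P t.
  by move=> ? ? ? ? t /= [<-|[<-|[<-|[<-|]]]].
pose G := [:: t0; t1; t2; t3].
have [[k0 k0n e0] u0 v0 g0 s0] := T0; have [[k1 k1n e1] u1 v1 g1 s1] := T1.
have [[k2 k2n e2] u2 v2 g2 s2] := T2; have [[k3 k3n e3] u3 v3 g3 s3] := T3.
have vG : valid_gate_protocol U G.
  by apply: allG; [move: u0|move: u1|move: u2|move: u3] => -[].
have oG : ordinary U G by apply: allG.
exists G; split=> //; last first.
- apply: allG; [exists k0|exists k1|exists k2|exists k3].
  + by constructor 1.
  + by constructor 2.
  + by constructor 3.
  + by constructor 4.
- by rewrite /num_settings /G !big_cons big_nil s0 s1 s2 s3 addn0 !addnA.
have nz (k l : C) (p q : 'cV[C]_(2 * 2)) : k != 0 -> l != 0 -> dot p q != 0 ->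
    dot (k *: p) (l *: q) != 0.
  by move=> kn ln pq; rewrite dotZl dotZr !mulf_neq0 ?cconj_eq0.
apply: (@star_verifies _ U G t0) => //; first by left.
  apply: allG; rewrite ?e0 ?e1 ?e2 ?e3; try exact: nz.
  apply: nz => //; rewrite dot_nrm (inj_eq (@complexI R) _ 0) nrm_eq0.
  exact: dot_neq0 d1.
move=> r rG; have rp k p t : k != 0 -> in_state t = k *: p -> List.In t G ->
    dot (adj r) p = 0.
  move=> kn e tG; apply: (mulfI kn); rewrite mulr0 -dotZr -e.
  by rewrite /dot adjK rG // mxE.
apply/eqP; rewrite -adj_eq0; apply/eqP/span.
- by apply: (rp _ _ _ k0n e0); left.
- by apply: (rp _ _ _ k1n e1); right; left.
- by apply: (rp _ _ _ k2n e2); right; right; left.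
- by apply: (rp _ _ _ k3n e3); right; right; right; left.
Qed.

Lemma cv4_eq0 (x y z w : C) : cconj x = 0 -> cconj y = 0 -> cconj z = 0 ->
  cconj w = 0 -> cv4 x y z w = 0.
Proof.
have J (a : C) : cconj a = 0 -> a = 0 by move/eqP; rewrite cconj_eq0 => /eqP.
move=> /J -> /J -> /J -> /J ->; rewrite -[LHS]scale1r.
by apply/colP => i; rewrite !mxE; case: i => [[|[|[|[|//]]]]] Hi; rewrite mulr0.
Qed.

Lemma cv2_neq0 (x y : C) : x != 0 -> cv2 x y != 0.
Proof. by apply: contra_neq => /colP/(_ 0); rewrite !mxE. Qed.

Lemma cv2_neq0r (x y : C) : y != 0 -> cv2 x y != 0.
Proof. by apply: contra_neq => /colP/(_ 1); rewrite !mxE. Qed.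

End GateProtocols.

(** * Counting settings, and explicit protocols in each case *)

Section Settings.
Variable R : realType.
Local Notation C := R[i].

Lemma sum_ge_size T (f : T -> nat) (G : seq T) :
  (forall t, List.In t G -> (0 < f t)%N) -> (size G <= \sum_(t <- G) f t)%N.
Proof.
elim: G => [|t G IH] fG /=; first by rewrite big_nil.
rewrite big_cons -add1n leq_add //; first by apply: fG; left.
by apply: IH => t' tG; apply: fG; right.
Qed.

Lemma sum_le_size T (f : T -> nat) (G : seq T) :
  (forall t, List.In t G -> (0 < f t)%N) -> (\sum_(t <- G) f t <= size G)%N ->
  forall t, List.In t G -> f t = 1%N.
Proof.
elim: G => [|t G IH] fG //=; rewrite big_cons => le.
have fG' t' : List.In t' G -> (0 < f t')%N by move=> tG; apply: fG; right.
have ft : (0 < f t)%N by apply: fG; left.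
have := sum_ge_size fG'; move=> ge t' [<-|tG].
  apply/eqP; rewrite eqn_leq ft andbT -(leq_add2r (size G)) add1n.
  by apply: leq_trans le; rewrite leq_add2l.
by apply: IH => //; rewrite -ltnS; apply: leq_trans le; rewrite -add1n leq_add2r.
Qed.

Lemma valid_out_prot U (G : seq (gate_test R)) : valid_gate_protocol U G ->
  forall t, List.In t G -> (0 < size (out_prot t))%N.
Proof.
move=> vG t /vG[_ [_ [_ [_ [_ w1]]]]]; rewrite lt0n; apply/eqP => /size0nil e.
by move/eqP: w1; rewrite e big_nil eq_sym oner_eq0.
Qed.

Lemma verifies_size U (G : seq (gate_test R)) : adj U *m U = 1%:M ->
  valid_gate_protocol U G -> verifies U G -> (4 <= size G)%N.
Proof.
move=> uU vG ver; rewrite leqNgt; apply/negP => lt4.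
have lt4' : (size [seq in_state t | t <- G] < 2 * 2)%N by rewrite size_map.
have [v v0 orth] := short_family_orthogonal lt4'.
apply: (orthogonal_not_verifies uU vG v0) ver => t tG; apply: orth.
exact: List.in_map.
Qed.

(** Subtracting [w ^+ 2] times the product condition of the input from that of the output leaves
    only the squared singlet amplitude, times [w ^+ 2 - w4 ^+ 2] up to sign. *)
Lemma swap_phase_product (w w4 : C) (a b : 'cV[C]_2) : w ^+ 2 <> w4 ^+ 2 ->
  product_state (bell_diag w w w w4 *m (a *t b)) -> dot (cv4 0 1 (-1) 0) (a *t b) = 0.
Proof.
move=> ne; have [a0 [a1 ->]] := cv2_ex a; have [b0 [b1 ->]] := cv2_ex b.
rewrite tens_cv2 => /bell_diag_product e.
have : (w ^+ 2 - w4 ^+ 2) * (a0 * b1 - a1 * b0) ^+ 2 = 0.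
  rewrite mulrBl.
  have -> : w4 ^+ 2 * (a0 * b1 - a1 * b0) ^+ 2 = w ^+ 2 * (a0 * b1 + a1 * b0) ^+ 2 -
    (w ^+ 2 * (a0 * b0 + a1 * b1) ^+ 2 - w ^+ 2 * (a0 * b0 - a1 * b1) ^+ 2).
    by rewrite e; ring.
  by ring.
move/eqP; rewrite mulf_eq0 subr_eq0 sqrf_eq0 => /orP[/eqP//|/eqP sym].
by rewrite dot_cv4 cconjN cconj1 cconj0 -[RHS]sym; ring.
Qed.

Lemma swap_phase_not_ef (w w4 : C) G : sqmod w = 1 -> sqmod w4 = 1 ->
  w ^+ 2 <> w4 ^+ 2 -> valid_gate_protocol (bell_diag w w w w4) G ->
  (forall t, List.In t G -> product_state (bell_diag w w w w4 *m in_state t)) ->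
  ~ verifies (bell_diag w w w w4) G.
Proof.
move=> u u4 ne vG pG; apply: (@orthogonal_not_verifies _ _ _ (cv4 0 1 (-1) 0)) => //.
- exact: bell_diag_unitary.
- rewrite -nrm_eq0 nrm_cv4 /sqmod /= !(expr0n, addr0, sqrrN, expr1n, oppr0, add0r).
  by rewrite -(natrD _ 1 1) pnatr_eq0.
- by move=> t tG; apply: (swap_phase_product ne); apply: pG.
Qed.

(** At least four tests are needed, so with four settings each test has exactly one. All outputs are
    then product states, which [swap_phase_not_ef] excludes. *)
Lemma swap_phase_ge5 (w w4 : C) G : sqmod w = 1 -> sqmod w4 = 1 ->
  w ^+ 2 <> w4 ^+ 2 -> valid_gate_protocol (bell_diag w w w w4) G ->
  ordinary (bell_diag w w w w4) G -> verifies (bell_diag w w w w4) G ->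
  (5 <= num_settings G)%N.
Proof.
move=> u u4 ne vG oG ver; have uU := bell_diag_unitary u u u u4.
have s4 := verifies_size uU vG ver.
rewrite leqNgt; apply/negP; rewrite ltnS => le4.
have s1 := sum_le_size (valid_out_prot vG) (leq_trans le4 s4).
apply: (swap_phase_not_ef u u4 ne vG) ver => t tG.
have [/unit_vecE uA [/unit_vecE uB vt]] := vG t tG; have gt := oG t tG.
move: vt gt (s1 t tG); case: (out_prot t) => [|s [|//]] //= vt gt _.
apply: (single_setting_product _ vt gt).
by apply/unit_vecE; rewrite dotMr mulmxA uU mul1mx dot_tens uA uB mulr1.
Qed.

Lemma swap_phase_protocol (w w4 : C) : sqmod w = 1 -> sqmod w4 = 1 ->
  exists G, [/\ valid_gate_protocol (bell_diag w w w w4) G,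
    ordinary (bell_diag w w w w4) G, verifies (bell_diag w w w w4) G &
    num_settings G = 5].
Proof.
move=> u u4; set U := bell_diag w w w w4; have uU : adj U *m U = 1%:M.
  exact: bell_diag_unitary.
have n1 : (1 : C) != 0 by apply: oner_neq0.
(* The condition [x1 = x2] says that the singlet amplitude is zero; the gate only multiplies such
   inputs by [w]. *)
have pr (a b c d x0 x1 x2 x3 : C) : cv2 a b != 0 -> cv2 c d != 0 ->
    cv4 x0 x1 x2 x3 = cv2 a b *t cv2 c d -> x1 = x2 ->
    exists t, testable U 1 (cv4 x0 x1 x2 x3) t.
  move=> ab cd xE x12; rewrite xE; apply: testable_product => //.
  have xp : x0 * x3 = x1 * x2 by apply/product_cv4; exists (cv2 a b), (cv2 c d).
  rewrite -xE; apply/bell_diag_product; rewrite -x12 subrr expr0n mulr0 subr0.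
  transitivity (4 * w ^+ 2 * (x0 * x3)); first by ring.
  by rewrite xp -x12; ring.
have t0 : exists t, testable U 1 (cv4 1 1 1 1) t.
  by apply: (pr 1 1 1 1); rewrite ?cv2_neq0 // tens_cv2 !mulr1.
have t1 : exists t, testable U 1 (cv4 1 0 0 0) t.
  by apply: (pr 1 0 1 0); rewrite ?cv2_neq0 // tens_cv2 !(mulr0, mul0r, mulr1).
have t2 : exists t, testable U 1 (cv4 0 0 0 1) t.
  by apply: (pr 0 1 0 1); rewrite ?cv2_neq0r // tens_cv2 !(mulr0, mul0r, mulr1).
(* An input with nonzero singlet amplitude completes the three symmetric ones to a basis; its output
   costs the fifth setting. *)
have t3 : exists t, testable U 2 (cv4 0 1 0 0) t.
  have inE' : cv2 1 0 *t cv2 0 1 = cv4 0 1 0 0 :> 'cV[C]_(2 * 2).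
    by rewrite tens_cv2 !(mulr0, mul0r, mulr1).
  have UE : U *m cv4 0 1 0 0 = cv4 0 ((w + w4) / 2) ((w - w4) / 2) 0.
    by rewrite bell_diag_cv4 !(subrr, addr0, subr0, mulr1, mulr0, mul0r).
  have [s1 [s2 [vs gs]]] : exists s1 s2,
      valid_state_protocol (U *m cv4 0 1 0 0) [:: s1; s2] /\
      pos_spectral_gap (U *m cv4 0 1 0 0) (ver_op [:: s1; s2]).
    rewrite UE; apply: two_setting_protocol.
    transitivity ((sqmod w + sqmod w4) / 2); last by rewrite u u4; field.
    have h2 : (2 : C)^-1 = cR 2^-1 by rewrite cRV cR_nat.
    by rewrite h2 /sqmod; case: (w) (w4) => ? ? [? ?] /=; field.
  exists (GateTest (cv2 1 0) (cv2 0 1) [:: s1; s2]); split=> //=.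
  - by exists 1 => //; rewrite scale1r.
  - by split; apply/unit_vecE; rewrite dot_cv2 cconj0 cconj1 !(mulr0, mulr1, addr0, add0r).
  - by rewrite /in_state /= inE'.
  - by rewrite /in_state /= inE'.
have := star_protocol uU t0 t1 t2 t3; rewrite !dot_cv4 !cconj1.
rewrite !(mulr0, mulr1, addr0, add0r) => /(_ n1 n1 n1)[v|G [vG oG ver nG _]]; last by exists G.
have [x [y [z [q ->]]]] := cv4_ex v; rewrite !dot_cv4.
rewrite !(mulr0, mulr1, addr0, add0r) => e0 ex eq' ey; apply: cv4_eq0 => //.
by move: e0; rewrite ex ey eq' !(addr0, add0r).
Qed.

Lemma ef_protocol_degenerate (w1 w2 w3 w4 : C) : sqmod w1 = 1 -> sqmod w2 = 1 ->
  sqmod w3 = 1 -> sqmod w4 = 1 -> w1 ^+ 2 = w2 ^+ 2 -> w3 ^+ 2 = w4 ^+ 2 ->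
  exists G, [/\ valid_gate_protocol (bell_diag w1 w2 w3 w4) G,
    ordinary (bell_diag w1 w2 w3 w4) G, verifies (bell_diag w1 w2 w3 w4) G,
    num_settings G = 4 &
    forall t, List.In t G -> product_state (bell_diag w1 w2 w3 w4 *m in_state t)].
Proof.
move=> u1 u2 u3 u4 w12 w34; set U := bell_diag w1 w2 w3 w4.
have uU : adj U *m U = 1%:M by apply: bell_diag_unitary.
have n1 : (1 : C) != 0 by apply: oner_neq0.
(* With squares equal in pairs the product condition reads [w2 ^+ 2 * (x0 * x3) = w4 ^+ 2 * (x1 *
   x2)]; it holds whenever one qubit of the input is in a computational basis state. *)
have Upr (x0 x1 x2 x3 : C) : x0 * x3 = 0 -> x1 * x2 = 0 ->
    product_state (U *m cv4 x0 x1 x2 x3).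
  move=> x03 x12; apply/bell_diag_product; rewrite w12 w34.
  transitivity (4 * w2 ^+ 2 * (x0 * x3)); first by ring.
  rewrite x03 mulr0; transitivity (4 * w4 ^+ 2 * (x1 * x2)); last by ring.
  by rewrite x12 mulr0.
have pr (a b c d x0 x1 x2 x3 : C) : cv2 a b != 0 -> cv2 c d != 0 ->
    cv4 x0 x1 x2 x3 = cv2 a b *t cv2 c d -> x0 * x3 = 0 -> x1 * x2 = 0 ->
    exists t, testable U 1 (cv4 x0 x1 x2 x3) t.
  move=> ab cd xE x03 x12; rewrite xE; apply: testable_product => //.
  by rewrite -xE; apply: Upr.
have t0 : exists t, testable U 1 (cv4 1 1 0 0) t.
  by apply: (pr 1 0 1 1); rewrite ?cv2_neq0 // ?tens_cv2 !(mulr0, mul0r, mulr1).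
have t1 : exists t, testable U 1 (cv4 1 0 0 0) t.
  by apply: (pr 1 0 1 0); rewrite ?cv2_neq0 // ?tens_cv2 !(mulr0, mul0r, mulr1).
have t2 : exists t, testable U 1 (cv4 1 0 1 0) t.
  by apply: (pr 1 1 1 0); rewrite ?cv2_neq0 // ?tens_cv2 !(mulr0, mul0r, mulr1).
have t3 : exists t, testable U 1 (cv4 0 1 0 1) t.
  by apply: (pr 1 1 0 1); [exact: cv2_neq0 | exact: cv2_neq0r
    | rewrite tens_cv2 !(mulr0, mul0r, mulr1) | rewrite mul0r | rewrite mulr0].
have := star_protocol uU t0 t1 t2 t3; rewrite !dot_cv4 !cconj1 !cconj0.
rewrite !(mulr0, mul0r, mulr1, addr0, add0r) => /(_ n1 n1 n1)[v|G [vG oG ver nG inG]].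
  have [x [y [z [q ->]]]] := cv4_ex v; rewrite !dot_cv4.
  rewrite !(mulr0, mulr1, addr0, add0r) => e0 ex exz eyq.
  rewrite ex add0r in e0; rewrite ex add0r in exz; rewrite e0 add0r in eyq.
  exact: cv4_eq0.
exists G; split=> // t /inG[k []] ->; rewrite -scalemxAr; apply: product_state_scale;
  by apply: Upr; rewrite !(mulr0, mul0r, mulr1).
Qed.

(* With [t * u = 'i] the input is sent to a product state iff [t ^+ 2 + u ^+ 2]
   solves a linear equation.  Multiplying the lower amplitudes of both qubits by
   ['i] or [- 'i], or exchanging the qubits, changes the sign of one Bell
   amplitude and thus keeps this property. *)
Lemma ef_protocol_generic (w1 w2 w3 w4 : C) : sqmod w1 = 1 -> sqmod w2 = 1 ->
  sqmod w3 = 1 -> sqmod w4 = 1 -> w3 ^+ 2 <> w4 ^+ 2 ->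
  ~ (w1 ^+ 2 = w2 ^+ 2 /\ w1 ^+ 2 = w3 ^+ 2) ->
  ~ (w1 ^+ 2 = w2 ^+ 2 /\ w1 ^+ 2 = w4 ^+ 2) ->
  exists G, [/\ valid_gate_protocol (bell_diag w1 w2 w3 w4) G,
    ordinary (bell_diag w1 w2 w3 w4) G, verifies (bell_diag w1 w2 w3 w4) G,
    num_settings G = 4 &
    forall t, List.In t G -> product_state (bell_diag w1 w2 w3 w4 *m in_state t)].
Proof.
move=> u1 u2 u3 u4 w34 w123 w124; set U := bell_diag w1 w2 w3 w4.
have uU : adj U *m U = 1%:M by apply: bell_diag_unitary.
have n1 : (1 : C) != 0 by apply: oner_neq0.
pose I := cI R; have II : I * I = -1 := cI2 R.
have I0 : I != 0 by apply: contra_eq_neq II => ->; rewrite mul0r eq_sym oppr_eq0.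
set W1 := w1 ^+ 2; set W2 := w2 ^+ 2; set W3 := w3 ^+ 2; set W4 := w4 ^+ 2.
have uW (w : C) : sqmod w = 1 -> sqmod (w ^+ 2) = 1.
  by move=> uw; rewrite expr2 sqmodM uw mulr1.
have d34 : W3 - W4 != 0 by rewrite subr_eq0; apply/eqP.
(* The input is [cv2 1 t *t cv2 1 u]. As [t * u = I], its first two Bell amplitudes [1 + I] and
   [1 - I] are nonzero with squares [2 * I] and [- (2 * I)]; the last clause makes the other two
   nonzero. *)
have [t [u [tu eqW sq0]]] : exists t u : C, [/\ t * u = I,
    2 * I * (W1 + W2) = W3 * (u + t) ^+ 2 - W4 * (u - t) ^+ 2 &
    t ^+ 2 - u ^+ 2 != 0].
  (* The product condition prescribes the value [m] for [t ^+ 2 + u ^+ 2]. With [s = t ^+ 2] and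
     [u ^+ 2 = - s^-1] this is the quadratic equation [s ^+ 2 = m * s + 1]. *)
  pose m := 2 * I * (W1 + W2 - W3 - W4) / (W3 - W4).
  pose s := (m + sqrtc (m ^+ 2 + 4)) / 2.
  have sE : s ^+ 2 = m * s + 1.
    have := sqr_sqrtc (m ^+ 2 + 4); rewrite /s; set r := sqrtc _ => rE.
    transitivity ((m ^+ 2 + 2 * m * r + r ^+ 2) / 4); first by field.
    by rewrite rE; field.
  have s0 : s != 0.
    by apply: contra_eq_neq sE => ->; rewrite expr0n mulr0 add0r eq_sym.
  pose t := sqrtc s; have tt : t ^+ 2 = s := sqr_sqrtc s.
  have t0 : t != 0 by rewrite -sqrf_eq0 tt.
  have uu : (I / t) ^+ 2 = - s^-1 by rewrite exprMn exprVn tt expr2 II mulN1r.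
  have mE : m = s - s^-1.
    by apply: (mulIf s0); rewrite mulrBl mulVf // -expr2 sE addrK.
  have tIt : t * (I / t) = I by rewrite mulrCA divff ?mulr1.
  have m2 : m * (W3 - W4) = 2 * I * (W1 + W2 - W3 - W4) by rewrite /m divfK.
  exists t, (I / t); split=> //.
    have -> : W3 * (I / t + t) ^+ 2 - W4 * (I / t - t) ^+ 2 =
        (W3 - W4) * ((I / t) ^+ 2 + t ^+ 2) + 2 * (t * (I / t)) * (W3 + W4) by ring.
    rewrite tIt tt uu; have -> : (W3 - W4) * (- s^-1 + s) = m * (W3 - W4).
      by rewrite mE; ring.
    by rewrite m2; ring.
  (* If [t ^+ 2 = u ^+ 2], then [s] is [I] or [- I], so [W1 + W2] is [2 * W3] or [2 * W4], and
     [sqmod_midpoint] yields an excluded triple coincidence. *)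
  rewrite tt uu opprK; apply/eqP => ss; have mss : m = 2 * s.
    by rewrite mE -[RHS]subr0 -ss; ring.
  have s2 : (s - I) * (s + I) = 0.
    have -> : (s - I) * (s + I) = s * (s + s^-1) - s * s^-1 - I * I by ring.
    by rewrite ss mulfV // II mulr0 sub0r opprK addNr.
  move/eqP: s2; rewrite mulf_eq0 subr_eq0 addr_eq0 => /orP[] /eqP sI.
    apply: w123; apply: sqmod_midpoint; rewrite ?uW //.
    apply: (mulfI (_ : 2 * I != 0)); first by rewrite mulf_neq0 ?pnatr_eq0.
    have -> : 2 * I * (w1 ^+ 2 + w2 ^+ 2) = 2 * I * (W1 + W2 - W3 - W4) + 2 * I * (W3 + W4).
      by rewrite -/W1 -/W2; ring.
    by rewrite -m2 mss sI -/W3; ring.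
  apply: w124; apply: sqmod_midpoint; rewrite ?uW //.
  apply: (mulfI (_ : 2 * I != 0)); first by rewrite mulf_neq0 ?pnatr_eq0.
  have -> : 2 * I * (w1 ^+ 2 + w2 ^+ 2) = 2 * I * (W1 + W2 - W3 - W4) + 2 * I * (W3 + W4).
    by rewrite -/W1 -/W2; ring.
  by rewrite -m2 mss sI -/W4; ring.
have u0 : u != 0 by apply: contra_eq_neq tu => ->; rewrite mulr0 eq_sym.
(* The input with exchanged qubits may be orthogonal to [p0]. The sign [e] avoids this: the overlaps
   for the two signs add up to 4. *)
have [e ee ov] : exists2 e : C, e * e = 1 & 2 + e * (cconj u * t + cconj t * u) != 0.
  have [o0|o0] := eqVneq (2 + (cconj u * t + cconj t * u)) 0; last first.
    by exists 1; rewrite ?mul1r.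
  exists (-1); first by rewrite mulrNN mulr1.
  rewrite mulN1r; have -> : 2 - (cconj u * t + cconj t * u) =
    4 - (2 + (cconj u * t + cconj t * u)) by ring.
  by rewrite o0 subr0 pnatr_eq0.
pose p0 := cv4 1 u t I; pose p1 := cv4 1 (I * u) (I * t) (- I).
pose p2 := cv4 1 (- I * u) (- I * t) (- I); pose p3 := cv4 1 (e * t) (e * u) I.
have sqI : (1 + I) ^+ 2 = 2 * I by rewrite sqrrD expr1n expr2 II; ring.
have sqI' : (1 - I) ^+ 2 = - (2 * I) by rewrite sqrrB expr1n expr2 II; ring.
have U0 : product_state (U *m p0).
  by apply/bell_diag_product; rewrite sqI sqI' -/W1 -/W2 -eqW; ring.
have U1 : product_state (U *m p1).
  apply/bell_diag_product; rewrite opprK sqI sqI' -mulrDr -mulrBr !exprMn.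
  by rewrite (expr2 I) II -/W1 -/W2 -/W3 -/W4 -[LHS]opprK -[RHS]opprK; congr (- _);
     transitivity (2 * I * (W1 + W2)); [ring | rewrite eqW; ring].
have U2 : product_state (U *m p2).
  apply/bell_diag_product; rewrite opprK sqI sqI' -mulrDr -mulrBr !exprMn.
  by rewrite sqrrN (expr2 I) II -/W1 -/W2 -/W3 -/W4 -[LHS]opprK -[RHS]opprK; congr (- _);
     transitivity (2 * I * (W1 + W2)); [ring | rewrite eqW; ring].
have U3 : product_state (U *m p3).
  apply/bell_diag_product; rewrite sqI sqI' -mulrDr -mulrBr !exprMn (expr2 e) ee.
  rewrite -/W1 -/W2 -/W3 -/W4.
  by transitivity (2 * I * (W1 + W2)); [ring | rewrite eqW; ring].
have te (a b c d : C) p : cv2 a b != 0 -> cv2 c d != 0 ->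
    p = cv2 a b *t cv2 c d -> product_state (U *m p) -> exists t, testable U 1 p t.
  by move=> ab cd ->; apply: testable_product.
have t0 : exists t, testable U 1 p0 t.
  by apply: (te 1 t 1 u) => //; rewrite ?cv2_neq0 // tens_cv2 !(mul1r, mulr1) tu.
have t1 : exists t, testable U 1 p1 t.
  apply: (te 1 (I * t) 1 (I * u)) => //; rewrite ?cv2_neq0 // tens_cv2 !(mul1r, mulr1).
  by rewrite mulrACA II tu mulN1r.
have t2 : exists t, testable U 1 p2 t.
  apply: (te 1 (- I * t) 1 (- I * u)) => //; rewrite ?cv2_neq0 // tens_cv2 !(mul1r, mulr1).
  by rewrite mulrACA mulrNN II tu mulN1r.
have t3 : exists t, testable U 1 p3 t.
  apply: (te 1 (e * u) 1 (e * t)) => //; rewrite ?cv2_neq0 // tens_cv2 !(mul1r, mulr1).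
  by rewrite mulrACA ee mul1r (mulrC u) tu.
have cI' : cconj I = - I := cconj_cI R.
have qpos : cR (sqmod u + sqmod t) != 0 :> C.
  rewrite (inj_eq (@complexI R) _ 0) gt_eqF // ltr_pwDl ?sqmod_ge0 //.
  by rewrite lt_neqAle sqmod_ge0 eq_sym sqmod_eq0 u0.
have d1 : dot p0 p1 != 0.
  rewrite dot_cv4 cconj1 cI' mulrNN II.
  have -> : 1 * 1 + cconj u * (I * u) + cconj t * (I * t) + -1 =
    I * (cconj u * u + cconj t * t) by ring.
  by rewrite -!sqmodE -cRD mulf_neq0.
have d2 : dot p0 p2 != 0.
  rewrite dot_cv4 cconj1 cI' mulrNN II.
  have -> : 1 * 1 + cconj u * (- I * u) + cconj t * (- I * t) + -1 =
    - I * (cconj u * u + cconj t * t) by ring.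
  by rewrite -!sqmodE -cRD mulf_neq0 ?oppr_eq0.
have d3 : dot p0 p3 != 0.
  rewrite dot_cv4 cconj1 cI' mulNr II.
  have -> // : 1 * 1 + cconj u * (e * t) + cconj t * (e * u) - -1 =
    2 + e * (cconj u * t + cconj t * u) by ring.
have [v|G [vG oG ver nG inG]] := star_protocol uU t0 t1 t2 t3 d1 d2 d3; last first.
  exists G; split=> // t' /inG[k []] ->; rewrite -scalemxAr;
    exact: product_state_scale.
have [r0 [r1 [r2 [r3 ->]]]] := cv4_ex v; rewrite !dot_cv4.
move: (cv4_eq0 (x := r0) (y := r1) (z := r2) (w := r3)).
move: (cconj r0) (cconj r1) (cconj r2) (cconj r3) => x0 x1 x2 x3 fin e0 e1 e2 e3.
have I20 : 2 * I != 0 by rewrite mulf_neq0 ?pnatr_eq0.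
(* The difference and the sum of [e1] and [e2] separate the middle from the outer coordinates; then
   [e0] gives [x3 = 0], and [e3] completes a linear system for [x1], [x2] with determinant
   [u ^+ 2 - t ^+ 2]. *)
have h12 : x1 * u + x2 * t = 0.
  by apply: (mulfI I20); rewrite mulr0 -[RHS](subrr 0) -{1}e1 -e2; ring.
have h0 : x0 = x3 * I.
  apply/eqP; rewrite -subr_eq0; apply/eqP/(mulfI (_ : (2 : C) != 0)).
    by rewrite pnatr_eq0.
  by rewrite mulr0 -[RHS](addr0 0) -{1}e1 -e2; ring.
have x30 : x3 = 0.
  apply: (mulIf I20); rewrite mul0r -e0 h0.
  transitivity (x3 * I * 1 + (x1 * u + x2 * t) + x3 * I); last by ring.
  by rewrite h12; ring.
have h12' : x1 * t + x2 * u = 0.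
  have e1' : e * (x1 * t + x2 * u) = 0 by rewrite -[RHS]e3 h0 x30; ring.
  by rewrite -[LHS]mul1r -ee -mulrA e1' mulr0.
have x20 : x2 = 0.
  apply: (mulIf sq0); rewrite mul0r.
  transitivity (t * (x1 * u + x2 * t) - u * (x1 * t + x2 * u)); first by ring.
  by rewrite h12 h12' !mulr0 subrr.
have x10 : x1 = 0.
  by move/eqP: h12; rewrite x20 mul0r addr0 mulf_eq0 (negPf u0) orbF => /eqP.
by apply: fin => //; rewrite h0 x30 mul0r.
Qed.

Lemma ef_protocol (w1 w2 w3 w4 : C) : sqmod w1 = 1 -> sqmod w2 = 1 ->
  sqmod w3 = 1 -> sqmod w4 = 1 ->
  (w3 ^+ 2 = w4 ^+ 2 /\ w1 ^+ 2 = w2 ^+ 2) \/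
  [/\ w3 ^+ 2 <> w4 ^+ 2, ~ (w1 ^+ 2 = w2 ^+ 2 /\ w1 ^+ 2 = w3 ^+ 2) &
      ~ (w1 ^+ 2 = w2 ^+ 2 /\ w1 ^+ 2 = w4 ^+ 2)] ->
  exists G, [/\ valid_gate_protocol (bell_diag w1 w2 w3 w4) G,
    ordinary (bell_diag w1 w2 w3 w4) G, verifies (bell_diag w1 w2 w3 w4) G,
    num_settings G = 4 &
    forall t, List.In t G -> product_state (bell_diag w1 w2 w3 w4 *m in_state t)].
Proof.
move=> u1 u2 u3 u4 [[w34 w12]|[w34 w123 w124]].
  exact: ef_protocol_degenerate.
exact: ef_protocol_generic.
Qed.
End Settings.

(** * The minimal numbers of settings and entanglement-free verifiability *)

Unset Implicit Arguments.

Theorem theorem5 (R : realType) (a1 a2 a3 : R) (U : 'M[R[i]]_(2 * 2)) :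
  0 <= a3 -> a3 <= a2 -> a2 <= a1 -> a1 <= pi / 4 ->
  is_canonU a1 a2 a3 U ->
  (inSEF a1 a2 a3 -> mu_is U 4) /\
  (inSE a1 a2 a3 -> mu_is U 5) /\
  (ef_verifiable U <-> inSEF a1 a2 a3).
Proof.
move=> a30 a32 a21 a1pi /canonU_bell_diag.
set w1 := cis _; set w2 := cis _; set w3 := cis _; set w4 := cis _ => UE.
have [u1 [u2 [u3 u4]]] : sqmod w1 = 1 /\ sqmod w2 = 1 /\ sqmod w3 = 1 /\ sqmod w4 = 1.
  by rewrite !sqmod_cis.
have uU : adj U *m U = 1%:M by rewrite UE; apply: bell_diag_unitary.
have EF : inSEF a1 a2 a3 -> exists G, [/\ valid_gate_protocol U G, ordinary U G,
    verifies U G, num_settings G = 4 &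
    forall t, List.In t G -> product_state (U *m in_state t)].
  by move=> /inSEF_phases W; rewrite UE; apply: ef_protocol.
have SE : inSE a1 a2 a3 -> U = bell_diag w3 w3 w3 w4 /\ w3 ^+ 2 <> w4 ^+ 2.
  by move=> /inSE_phases[e1 e2 ne]; rewrite UE /w1 /w2 e1 e2.
split=> [|].
  move=> /EF[G [vG oG ver nG _]]; split; first by exists G.
  (* At least four tests are necessary, and each contains at least one setting. *)
  move=> G' vG' _ ver'; apply: leq_trans (verifies_size uU vG' ver') _.
  exact: sum_ge_size (valid_out_prot vG').
split.
  move=> /SE[UE' ne]; rewrite UE'; split; first exact: swap_phase_protocol.
  by move=> G vG oG ver; apply: (swap_phase_ge5 u3 u4 ne vG oG ver).
split=> [[G [vG ver pG]]|/EF[G [vG _ ver _ pG]]]; last by exists G.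
split; first by [].
move=> /SE[UE' ne]; rewrite UE' in vG ver pG.
exact: (swap_phase_not_ef u3 u4 ne vG pG ver).
Qed.
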